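(* Let $\mathbb{A} = S^1 \times [0,1]$ and let $f:\mathbb{A}\rightarrow\mathbb{A}$ be a homeomorphism satisfying the twist condition and the intersection property. Then $f$ has at least one fixed point in $\mathbb{A}$.
   Context: Notation: $S^1=\mathbb{R}/\mathbb{Z}$, and $\mathbb{A} = S^1 \times [0,1]$ is the closed annulus with boundary components $A_0 = S^1 \times \{0\}$ and $A_1 = S^1 \times \{1\}$. Its covering space is $\widetilde{\mathbb{A}} = \mathbb{R} \times [0,1]$, with covering map $\pi(x,y) = (x \bmod 1, y)$. A lift of $f$ is a homeomorphism $\widetilde{f}:\widetilde{\mathbb{A}}\to\widetilde{\mathbb{A}}$ with $\pi\circ\widetilde{f}=f\circ\pi$. Twist condition: $f$ has a lift $\widetilde{f}$ that moves the two boundary components of $\widetilde{\mathbb{A}}$ in opposite directions, in the following sense: $\widetilde{f}(x,1) = (x+r_1(x),1)$ and $\widetilde{f}(x,0) = (x-r_0(x),0)$ for all $x\in\mathbb{R}$, where $r_0(x)>0$ and $r_1(x) >0$ for all $x$. Intersection property: for every essential simple closed curve $\gamma\subset\mathbb{A}$, one has $f(\gamma)\cap\gamma\neq\varnothing$. A simple closed curve in $\mathbb{A}$ is essential if it is not contractible in $\mathbb{A}$. *)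

(* Defs.v *)
From HB Require Import structures.
From mathcomp Require Import all_boot all_order all_algebra generic_quotient.
From mathcomp Require Import all_classical all_reals all_analysis.

Set Implicit Arguments.
Unset Strict Implicit.
Unset Printing Implicit Defensive.

Import Order.TTheory GRing.Theory Num.Theory.
Import numFieldNormedType.Exports.

Local Open Scope classical_set_scope.
Local Open Scope ring_scope.
Local Open Scope quotient_scope.

Definition homeomorphism (X Y : topologicalType) (f : X -> Y) : Prop :=
  continuous f /\
  exists g : Y -> X, [/\ continuous g, cancel f g & cancel g f].

Definition eqmod1 (R : realType) : rel R := fun x y => (x - y) \is a Num.int.

Lemma eqmod1_refl (R : realType) : reflexive (@eqmod1 R).
Proof. by move=> x; rewrite /eqmod1 subrr rpred0. Qed.

Lemma eqmod1_sym (R : realType) : symmetric (@eqmod1 R).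
Proof. by move=> x y; rewrite /eqmod1 -opprB rpredN. Qed.

Lemma eqmod1_trans (R : realType) : transitive (@eqmod1 R).
Proof.
by move=> y x z xy yz; rewrite /eqmod1 -(subrKA y); exact: rpredD.
Qed.

Definition eqmod1_equiv (R : realType) : equiv_rel R :=
  EquivRel (@eqmod1 R) (@eqmod1_refl R) (@eqmod1_sym R) (@eqmod1_trans R).

Definition circle (R : realType) : topologicalType :=
  quotient_topology {eq_quot (eqmod1_equiv R)}.

Definition circle_pi (R : realType) (x : R) : circle R :=
  \pi_(quotient_topology {eq_quot (eqmod1_equiv R)}) x.

Lemma circle_piP (R : realType) (x y : R) :
  circle_pi x = circle_pi y <-> (x - y) \is a Num.int.
Proof. exact: (rwP (@eqquotP _ _ {eq_quot (eqmod1_equiv R)} x y)). Qed.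

Definition unit_interval (R : realType) : topologicalType :=
  set_type (`[0, 1]%classic : set R).

Lemma mem_unit_interval0 (R : realType) : (0 : R) \in (`[0, 1]%classic : set R).
Proof. by apply/mem_set; rewrite /= in_itv /= lexx ler01. Qed.

Lemma mem_unit_interval1 (R : realType) : (1 : R) \in (`[0, 1]%classic : set R).
Proof. by apply/mem_set; rewrite /= in_itv /= lexx ler01. Qed.

Definition I0 (R : realType) : unit_interval R :=
  exist _ 0 (mem_unit_interval0 R).
Definition I1 (R : realType) : unit_interval R :=
  exist _ 1 (mem_unit_interval1 R).

Definition annulus (R : realType) : topologicalType :=
  (circle R * unit_interval R)%type.

Definition strip (R : realType) : topologicalType :=
  (R * unit_interval R)%type.

Definition annulus_pi (R : realType) (p : strip R) : annulus R :=
  (circle_pi p.1, p.2).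

Definition is_lift (R : realType)
    (f : annulus R -> annulus R) (F : strip R -> strip R) : Prop :=
  homeomorphism F /\ @annulus_pi R \o F =1 f \o @annulus_pi R.

Definition twist_condition (R : realType) (f : annulus R -> annulus R) : Prop :=
  exists2 F : strip R -> strip R, is_lift f F &
  exists r0 r1 : R -> R, forall x : R,
    [/\ 0 < r0 x, 0 < r1 x,
        F (x, I1 R) = (x + r1 x, I1 R) &
        F (x, I0 R) = (x - r0 x, I0 R)].

(* A simple closed curve is given by a parametrization by the circle; the curve
   itself, as a subset of the annulus, is [range c]. *)
Definition simple_closed_curve (R : realType) (c : circle R -> annulus R) : Prop :=
  continuous c /\ injective c.

(* Free homotopy to a constant map. *)
Definition contractible_curve (R : realType) (c : circle R -> annulus R) : Prop :=
  exists (H : (circle R * unit_interval R)%type -> annulus R) (p : annulus R),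
    [/\ continuous H,
        forall s, H (s, I0 R) = c s &
        forall s, H (s, I1 R) = p].

Definition essential_curve (R : realType) (c : circle R -> annulus R) : Prop :=
  ~ contractible_curve c.

Definition intersection_property (R : realType)
    (f : annulus R -> annulus R) : Prop :=
  forall c : circle R -> annulus R,
    simple_closed_curve c -> essential_curve c ->
    (f @` range c) `&` range c !=set0.

(* Main.v *)
Require Import Defs.
From mathcomp Require Import all_boot all_order all_algebra.
From mathcomp Require Import all_fingroup generic_quotient.
From mathcomp Require Import all_classical all_reals all_analysis.
From mathcomp Require Import zify ring lra.

Set Implicit Arguments.
Unset Strict Implicit.
Unset Printing Implicit Defensive.

Import Order.TTheory GRing.Theory Num.Theory.
Import numFieldNormedType.Exports.

Local Open Scope classical_set_scope.
Local Open Scope ring_scope.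

(** Suppose that [f] has no fixed point, so that its lift [F] has none, and
    follow the direction of the vector [F z - z] along a path from the lower to
    the upper edge of the strip. It turns from left to right, by an odd multiple
    of the half turn [pi] that does not depend on the path.

    Cut the strip into bricks much smaller than the displacement of [F], and let
    [A] be the union of the bricks reached from the bottom row by chains in which
    [F] maps a point of each brick into the next one. If [A] misses the top row,
    then [F] maps [A] away from the other bricks, hence the boundary of [A] away
    from itself, and this boundary contains an essential simple closed curve:
    the intersection property fails. So some chain joins the bottom row to the
    top row. The bricks of a shortest such chain are distinct, and pushing points
    inside each of them perturbs [F] into a homeomorphism [G], with directions
    close to those of [F], that has an orbit crossing the strip (after Franks).

    Let [g] be a path with [g (t + 1) = G (g t)] that follows this orbit (after
    Brown and Neumann). The chords [g t - g s] with [t >= s + 1] do not vanish.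
    The direction of [g (s + 1) - g s] therefore turns as along the chords that
    first start at the bottom of the path and then end at its top. These all
    point upwards, so the vector turns through the upper half plane: the
    rotation of [F] is exactly [- pi].

    The inverse of [F], mirrored in a vertical line, satisfies the same
    hypotheses, and its rotation is the opposite of that of [F]: a
    contradiction. *)

(** * Continuity *)

Section Continuity.
Context {R : realType} {T : topologicalType}.
Implicit Types f g : T -> R.

Lemma fun_continuousD f g :
  continuous f -> continuous g -> continuous (fun x => f x + g x).
Proof. by move=> cf cg x; apply: (@continuousD R R^o T); [exact: cf|exact: cg]. Qed.

Lemma fun_continuousN f : continuous f -> continuous (fun x => - f x).
Proof. by move=> cf x; apply: (@continuousN R R^o T); exact: cf. Qed.

Lemma fun_continuousM f g :
  continuous f -> continuous g -> continuous (fun x => f x * g x).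
Proof. by move=> cf cg x; apply: (@continuousM R T); [exact: cf|exact: cg]. Qed.

Lemma fun_continuousV f :
  continuous f -> (forall x, f x != 0) -> continuous (fun x => (f x)^-1).
Proof. by move=> cf f0 x; apply: (@continuousV R T) => //; exact: cf. Qed.

Lemma fun_continuous_max f g :
  continuous f -> continuous g -> continuous (fun x => Num.max (f x) (g x)).
Proof. by move=> cf cg x; apply: (@continuous_max R T); [exact: cf|exact: cg]. Qed.

Lemma fun_continuous_min f g :
  continuous f -> continuous g -> continuous (fun x => Num.min (f x) (g x)).
Proof. by move=> cf cg x; apply: (@continuous_min R T); [exact: cf|exact: cg]. Qed.

Lemma fun_continuous_norm f : continuous f -> continuous (fun x => `|f x|).
Proof.
move=> cf x; apply: (@continuous_comp _ _ _ f (@Num.Def.normr R R^o)).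
  exact: cf.
exact: (@norm_continuous R R^o).
Qed.

Lemma fun_continuous_comp (U V : topologicalType) (h : U -> V) (k : T -> U) :
  continuous h -> continuous k -> continuous (fun x => h (k x)).
Proof. by move=> ch ck x; apply: continuous_comp; [exact: ck|exact: ch]. Qed.

Lemma fun_continuous_pair (U V : topologicalType) (h : T -> U) (k : T -> V) :
  continuous h -> continuous k -> continuous (fun x => (h x, k x)).
Proof. by move=> ch ck x; apply: cvg_pair; [exact: ch|exact: ck]. Qed.

Lemma fun_continuous_fst (U V : topologicalType) (h : T -> U * V) :
  continuous h -> continuous (fun x => (h x).1).
Proof. by move=> ch x; apply: cvg_comp; [exact: ch|exact: cvg_fst]. Qed.

Lemma fun_continuous_snd (U V : topologicalType) (h : T -> U * V) :
  continuous h -> continuous (fun x => (h x).2).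
Proof. by move=> ch x; apply: cvg_comp; [exact: ch|exact: cvg_snd]. Qed.

Lemma fun_continuous_id : continuous (fun x : T => x).
Proof. by move=> x; exact: cvg_id. Qed.

Lemma fun_continuous_cst (U : topologicalType) (a : U) :
  continuous (fun _ : T => a).
Proof. by move=> x; exact: cvg_cst. Qed.

Lemma fun_continuous_sum n (f : nat -> T -> R) :
  (forall i, continuous (f i)) -> continuous (fun x => \sum_(i < n) f i x).
Proof.
move=> cf; elim: n => [|n IHn].
  under [X in continuous X]funext do rewrite big_ord0.
  exact: fun_continuous_cst.
under [X in continuous X]funext do rewrite big_ord_recr /=.
exact: fun_continuousD.
Qed.

End Continuity.

Ltac cont_step :=
  lazymatch goal with
  | |- continuous (fun x => x) => exact: fun_continuous_id
  | |- continuous (fun _ => ?a) => exact: fun_continuous_cst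
  | |- continuous (fun x => (@?f x, @?g x)) =>
      apply: (@fun_continuous_pair _ _ _ f g)
  | |- continuous (fun x => fst (@?f x)) => apply: (@fun_continuous_fst _ _ _ f)
  | |- continuous (fun x => snd (@?f x)) => apply: (@fun_continuous_snd _ _ _ f)
  | |- continuous (fun x => @?f x + @?g x) => apply: (@fun_continuousD _ _ f g)
  | |- continuous (fun x => @?f x * @?g x) => apply: (@fun_continuousM _ _ f g)
  | |- continuous (fun x => - @?f x) => apply: (@fun_continuousN _ _ f)
  | |- continuous (fun x => (@?f x)^-1) => apply: (@fun_continuousV _ _ f)
  | |- continuous (fun x => Num.max (@?f x) (@?g x)) =>
      apply: (@fun_continuous_max _ _ f g)
  | |- continuous (fun x => Num.min (@?f x) (@?g x)) =>
      apply: (@fun_continuous_min _ _ f g)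
  | |- continuous (fun x => `|@?f x|) => apply: (@fun_continuous_norm _ _ f)
  | |- continuous (fun x => ?h (@?k x)) =>
      apply: (@fun_continuous_comp _ _ _ h k)
  end.
Ltac cont := repeat (first [assumption | cont_step]).

(** * Angle functions *)

Section Angle.
Context {R : realType}.
Implicit Types (a b : R * R) (s t : R).

Definition dot a b : R := a.1 * b.1 + a.2 * b.2.
Definition cross a b : R := a.1 * b.2 - a.2 * b.1.

Definition angle_of a t := exists2 r : R, 0 < r & a = (r * cos t, r * sin t).

Lemma dot_gt0 a : a != (0, 0) -> 0 < dot a a.
Proof.
case: a => x y; rewrite /dot /= xpair_eqE negb_and -!expr2.
by case/orP => h; [apply: ltr_wpDr|apply: ltr_wpDl];
  rewrite ?sqr_ge0// lt0r sqrf_eq0 h sqr_ge0.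
Qed.

(** Since [b] lies in the open half plane around [a], the signed angle from [a] to [b] is the
    arctangent of [cross / dot], an expression continuous in both vectors. *)
Lemma angle_rotate a b t : angle_of a t -> 0 < dot a b ->
  angle_of b (t + atan (cross a b / dot a b)).
Proof.
move=> [r r0 ->] d0; set q := _ / _.
have c0 : 0 < cos (atan q).
  by apply: cos_gt0_pihalf; rewrite atan_gtNpi2 atan_ltpi2.
have sE : sin (atan q) = q * cos (atan q).
  by rewrite -[X in X * _](@atanK R) /tan divfK// gt_eqF.
exists (dot (r * cos t, r * sin t) b / (r * cos (atan q))).
  by rewrite divr_gt0// mulr_gt0.
rewrite cosD sinD sE.
have := cos2Dsin2 t; move: d0; rewrite /q /dot /cross /=.
move: (cos (atan _)) c0 => c c0 {sE q}; move: (cos t) (sin t) => C S.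
case: b => u v /= d0 CS.
have r1 : r != 0 by rewrite gt_eqF.
have c1 : c != 0 by rewrite gt_eqF.
have d1 : r * C * u + r * S * v != 0 by rewrite gt_eqF.
congr pair.
  transitivity (u * (C ^+ 2 + S ^+ 2)); first by rewrite CS mulr1.
  by field; rewrite c1 r1 d1.
transitivity (v * (C ^+ 2 + S ^+ 2)); first by rewrite CS mulr1.
by field; rewrite c1 r1 d1.
Qed.

(** One of the four half axes, whose angles are known, makes an acute angle with [a], and
    [angle_rotate] starts from it. *)
Lemma angle_exists a : a != (0, 0) -> exists t, angle_of a t.
Proof.
case: a => x y a0.
have rot u v t : angle_of (u, v) t -> 0 < u * x + v * y ->
    exists s, angle_of (x, y) s.
  by move=> h d; eexists; apply: (angle_rotate h); exact: d.
have [x0|x0|x0] := ltgtP x 0.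
- apply: (rot (-1) 0 pi); last by lra.
  by exists 1; rewrite ?ltr01// cospi sinpi mul1r mulr0.
- apply: (rot 1 0 0); last by lra.
  by exists 1; rewrite ?ltr01// cos0 sin0 mul1r mulr0.
move: a0; rewrite xpair_eqE x0 eqxx /= => y0.
have [y1|y1|y1] := ltgtP y 0; last by rewrite y1 eqxx in y0.
- rewrite -x0.
  apply: (rot 0 (-1) (- (pi / 2))); last by lra.
  by exists 1; rewrite ?ltr01// cosN sinN cos_pihalf sin_pihalf !mul1r.
- rewrite -x0; apply: (rot 0 1 (pi / 2)); last by lra.
  by exists 1; rewrite ?ltr01// cos_pihalf sin_pihalf !mul1r.
Qed.

Lemma angle_cos_gt0 a b s t : angle_of a s -> angle_of b t -> 0 < dot a b ->
  0 < cos (s - t).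
Proof.
move=> [r r0 ->] [q q0 ->]; rewrite /dot /= cosB.
have -> : r * cos s * (q * cos t) + r * sin s * (q * sin t) =
  (r * q) * (cos s * cos t + sin s * sin t) by ring.
by rewrite pmulr_rgt0// mulr_gt0.
Qed.

Lemma angle_cos_eq1 a s t : angle_of a s -> angle_of a t -> cos (s - t) = 1.
Proof.
move=> [r r0 ->] [q q0 [e1 e2]]; rewrite cosB.
have C1 := cos2Dsin2 s; have C2 := cos2Dsin2 t.
have rq : r = q.
  apply: (pexpIrn (isT : (0 < 2)%N)); rewrite ?nnegrE ?ltW//.
  transitivity ((r * cos s) ^+ 2 + (r * sin s) ^+ 2).
    by rewrite !exprMn -mulrDr C1 mulr1.
  by rewrite e1 e2 !exprMn -mulrDr C2 mulr1.
rewrite rq in e1 e2; have q1 : q != 0 by rewrite gt_eqF.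
by rewrite (mulfI q1 e1) (mulfI q1 e2) -!expr2.
Qed.

Lemma cos_eq1_small t : cos t = 1 -> `|t| < pi -> t = 0.
Proof.
move=> ct tpi; apply: normr0_eq0; apply: (@cos_inj R).
- by rewrite in_itv /= normr_ge0 ltW.
- by rewrite in_itv /= lexx pi_ge0.
rewrite cos0 -ct; case: (leP 0 t) => h; first by rewrite ger0_norm.
by rewrite ltr0_norm// cosN.
Qed.

Lemma ivt (d : R -> R) (a b v : R) : continuous d -> a <= b ->
  Num.min (d a) (d b) <= v <= Num.max (d a) (d b) ->
  exists2 c, a <= c <= b & d c = v.
Proof.
move=> cd ab h; have := @IVT R d a b v ab (continuous_subspaceT cd) h.
by case=> c; rewrite in_itv /= => cab dc; exists c.
Qed.

(** Here [d a] is a multiple of [2 pi], so to move away by [pi / 2] the path would have to cross a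
    zero of the cosine. *)
Lemma cos_gt0_path (d : R -> R) (a b : R) : continuous d -> a <= b ->
  (forall t, a <= t <= b -> 0 < cos (d t)) -> cos (d a) = 1 ->
  `|d b - d a| < pi / 2.
Proof.
move=> cd ab dpos da1; rewrite ltNge; apply/negP => dab.
have sa0 : sin (d a) = 0.
  have := cos2Dsin2 (d a); rewrite da1 expr1n => /eqP.
  by rewrite -subr_eq0 addrAC subrr add0r sqrf_eq0 => /eqP.
have pi0 := @pi_gt0 R.
move: dab; rewrite ler_normr => /orP[h|h].
- have [|c /dpos] := @ivt d a b (d a + pi / 2) cd ab.
    by rewrite ge_min le_max; apply/andP; split; apply/orP; [left|right]; lra.
  by move=> h2 e; move: h2; rewrite e cosDpihalf sa0 oppr0 ltxx.
- have [|c /dpos] := @ivt d a b (d a - pi / 2) cd ab.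
    by rewrite ge_min le_max; apply/andP; split; apply/orP; [right|left]; lra.
  by move=> h2 e; move: h2; rewrite e cosBpihalf sa0 ltxx.
Qed.

(** Applied to the difference [d] of two continuous angles of one vector: it takes values in a
    discrete set, so angles are unique up to a constant. *)
Lemma cos_eq1_path (d : R -> R) (a b : R) : continuous d -> a <= b ->
  (forall t, a <= t <= b -> cos (d t) = 1) -> d b = d a.
Proof.
move=> cd ab h; apply/eqP; rewrite -subr_eq0; apply/eqP/cos_eq1_small.
  have ha : cos (d a) = 1 by apply: h; rewrite lexx.
  have hb : cos (d b) = 1 by apply: h; rewrite lexx ab.
  have := cos2Dsin2 (d a); rewrite ha expr1n => /eqP.
  rewrite -subr_eq0 addrAC subrr add0r sqrf_eq0 => /eqP sa.
  by rewrite cosB ha hb sa !mulr0 addr0 mulr1.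
have pi0 := @pi_gt0 R.
apply: (@lt_trans _ _ (pi / 2)); last by lra.
apply: cos_gt0_path => // [t /h ->|]; first exact: ltr01.
by apply: h; rewrite lexx.
Qed.

Lemma sin_ge0_path (d : R -> R) (a b : R) : continuous d -> a <= b ->
  (forall t, a <= t <= b -> 0 <= sin (d t)) -> `|d b - d a| <= pi.
Proof.
move=> cd ab dpos; rewrite leNgt; apply/negP => dab.
have pi0 := @pi_gt0 R.
(* If [e] increases by more than [pi], then [sin] vanishes at [e a], where
     [cos] is nonnegative, hence [sin] is negative just after the half turn. *)
have key (e : R -> R) : (forall v, e a <= v <= e b -> 0 <= sin v) ->
    pi < e b - e a -> False.
  move=> ep eab.
  have s0 : 0 <= sin (e a) by apply: ep; lra.
  have := ep (e a + pi); rewrite sinDpi => /(_ ltac:(lra)) s1.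
  have sa0 : sin (e a) = 0 by lra.
  have c0 : 0 <= cos (e a).
    by rewrite -sinDpihalf; apply: ep; lra.
  pose u := Num.min (pi / 2) (e b - e a - pi).
  have u0 : 0 < u by rewrite lt_min; apply/andP; split; lra.
  have ub : u <= e b - e a - pi by rewrite ge_min lexx orbT.
  have up : u <= pi / 2 by rewrite ge_min lexx.
  have := ep (e a + u + pi); rewrite sinDpi => /(_ ltac:(lra)).
  rewrite sinD sa0 mul0r add0r.
  have cE : cos (e a) = 1.
    have := cos2Dsin2 (e a); rewrite sa0 expr0n addr0 => /eqP.
    by rewrite -[X in _ == X](expr1n _ 2) eqrXn2// => /eqP.
  rewrite cE mul1r; have := @sin_gt0_pi R u; rewrite u0 /= => /(_ ltac:(lra)).
  lra.
move: dab; rewrite ltr_normr => /orP[h|h].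
- apply: (key d) => // v vab; have [|c /dpos] := @ivt d a b v cd ab.
    by rewrite ge_min le_max; apply/andP; split; apply/orP; [left|right]; lra.
  by move=> ? <-.
(* Replacing [d] by [pi - d] keeps the sine and turns a decrease into an increase. *)
- apply: (key (fun t => pi - d t)); last by lra.
  move=> v vab; have [|c /dpos h2 e] := @ivt d a b (pi - v) cd ab.
    by rewrite ge_min le_max; apply/andP; split; apply/orP; [right|left]; lra.
  move: h2; rewrite e.
  have -> : pi - v = - v + pi by ring.
  by rewrite sinDpi sinN opprK.
Qed.

End Angle.

(** * Continuous angle of a nonvanishing vector field on the plane *)

Section AngleLift.
Context {R : realType}.
Implicit Types (z : R * R) (k t : R).

Definition clamp k t : R := Num.max (- k) (Num.min t k).
Definition clamp2 k z : R * R := (clamp k z.1, clamp k z.2).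

Lemma clamp_id k t : `|t| <= k -> clamp k t = t.
Proof.
rewrite ler_norml => /andP[t1 t2].
by rewrite /clamp min_l// max_r.
Qed.

Lemma clamp_le k t : 0 <= k -> `|clamp k t| <= k.
Proof.
move=> k0; rewrite ler_norml /clamp le_max lexx /= ge_max.
by rewrite ge_min lexx orbT andbT; lra.
Qed.

Lemma clamp_continuous k : continuous (clamp k).
Proof. by rewrite /clamp; cont. Qed.

Lemma compact_box k : compact [set z : R * R | `|z.1| <= k /\ `|z.2| <= k].
Proof.
have -> : [set z : R * R | `|z.1| <= k /\ `|z.2| <= k] =
    `[- k, k]%classic `*` `[- k, k]%classic.
  by apply/seteqP; split => -[x y] /=; rewrite !in_itv /= !ler_norml.
by apply: compact_setX; exact: segment_compact.
Qed.

(** The pairs of points of the box at which [W] has nonpositive dot product form a compact set [C]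
    off the diagonal, hence at positive distance from it. Steps along rays shorter than this
    distance avoid [C]. *)
Lemma subdivision (W : R * R -> R * R) k : continuous W ->
  (forall z, W z != (0, 0)) -> 0 < k ->
  exists2 n, (0 < n)%N & forall i (z : R * R), (i < n)%N ->
    `|z.1| <= k -> `|z.2| <= k ->
    0 < dot (W (i%:R / n%:R * z.1, i%:R / n%:R * z.2))
            (W (i.+1%:R / n%:R * z.1, i.+1%:R / n%:R * z.2)).
Proof.
move=> cW W0 k0.
pose B := [set z : R * R | `|z.1| <= k /\ `|z.2| <= k].
pose D (p : (R * R) * (R * R)) := dot (W p.1) (W p.2).
pose C := (B `*` B) `&` [set p | D p <= 0].
have cD : continuous D by rewrite /D /dot; cont.
have cC : compact C.
  apply: compact_closedI; first by apply: compact_setX; exact: compact_box.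
  by apply: (preimage_closed _ (@closed_le _ 0)) => y _; exact: cD.
pose g (p : (R * R) * (R * R)) :=
  Num.max `|p.1.1 - p.2.1| `|p.1.2 - p.2.2|.
have cg : continuous g by rewrite /g; cont.
have inB n i z : (0 < n)%N -> (i <= n)%N -> B z ->
    B (i%:R / n%:R * z.1, i%:R / n%:R * z.2).
  move=> n0 ni [z1 z2].
  have h : `|i%:R / n%:R : R| <= 1.
    by rewrite ger0_norm// ler_pdivrMr ?ltr0n// mul1r ler_nat.
  by split; rewrite /= normrM; [apply: le_trans z1|apply: le_trans z2];
    apply: ler_piMl.
have [[p0 Cp0]|C0] := pselect (C !=set0); last first.
  exists 1%N => // i z i1 z1 z2; rewrite ltNge; apply/negP => h.
  apply: C0; exists ((i%:R / 1%:R * z.1, i%:R / 1%:R * z.2),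
    (i.+1%:R / 1%:R * z.1, i.+1%:R / 1%:R * z.2)); split=> //.
  by split; apply: inB => //; exact: ltnW.
have [|p pC pmin] := compact_EVT_min _ cC (continuous_subspaceT cg).
  by exists p0.
have g0 : 0 < g p.
  rewrite lt_neqAle; apply/andP; split; last first.
    by rewrite /g le_max normr_ge0.
  rewrite eq_sym; apply/negP => /eqP gp.
  have e : p.1 = p.2.
    case: (p) gp => -[x y] [u v]; rewrite /g /= => gp.
    have : `|x - u| <= 0 by rewrite -gp le_max lexx.
    have : `|y - v| <= 0 by rewrite -gp le_max lexx orbT.
    by rewrite !normr_le0 !subr_eq0 => /eqP -> /eqP ->.
  move: pC; rewrite inE => -[_]; rewrite /= /D e.
  by rewrite leNgt dot_gt0.
pose n := (Num.truncn (k / g p)).+1.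
have kn : k / n%:R < g p.
  rewrite ltr_pdivrMr ?ltr0n// mulrC -ltr_pdivrMr//.
  exact: truncnS_gt.
exists n => // i z ni z1 z2; rewrite ltNge; apply/negP => h.
have /pmin : ((i%:R / n%:R * z.1, i%:R / n%:R * z.2),
    (i.+1%:R / n%:R * z.1, i.+1%:R / n%:R * z.2)) \in C.
  by rewrite inE; split=> //; split; apply: inB => //; exact: ltnW.
apply/negP; rewrite -ltNge; apply: le_lt_trans kn.
have e t : i%:R / n%:R * t - i.+1%:R / n%:R * t = - (t / n%:R).
  rewrite -addn1 natrD; ring.
rewrite /g /= !e !normrN !normrM ge_max (@ger0_norm _ n%:R^-1) ?invr_ge0//.
by rewrite !ler_wpM2r// invr_ge0.
Qed.

(** The angle at [z] is obtained by adding up the signed angles between [n] successive values of [W]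
    on the segment from the origin to [z]. *)
Lemma angle_lift_box (W : R * R -> R * R) k t0 : continuous W ->
  (forall z, W z != (0, 0)) -> 0 < k -> angle_of (W (0, 0)) t0 ->
  exists th : R * R -> R, [/\ continuous th,
    forall z, `|z.1| <= k -> `|z.2| <= k -> angle_of (W z) (th z) &
    th (0, 0) = t0].
Proof.
move=> cW W0 k0 a0; have [n n0 nP] := subdivision cW W0 k0.
pose w i z := W (i%:R / n%:R * clamp k z.1, i%:R / n%:R * clamp k z.2).
have cw i : continuous (w i).
  have cc := @clamp_continuous k.
  by rewrite /w; cont.
have dw i z : (i < n)%N -> 0 < dot (w i z) (w i.+1 z).
  move=> ni; exact: (nP i (clamp2 k z) ni (clamp_le _ (ltW k0))
    (clamp_le _ (ltW k0))).
(* The value 0 from [n] on makes every [s i] continuous, as [fun_continuous_sum] requires. *)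
pose s i z := if (i < n)%N then
  atan (cross (w i z) (w i.+1 z) / dot (w i z) (w i.+1 z)) else 0.
have cs i : continuous (s i).
  rewrite /s; case: ltnP => ni; last by cont.
  have ca : continuous (@atan R) by move=> x; exact: continuous_atan.
  have ci := cw i; have ci1 := cw i.+1.
  apply: (fun_continuous_comp ca); rewrite /cross /dot; cont => z.
  by rewrite -/(dot _ _) gt_eqF// dw.
pose th j z := t0 + \sum_(i < j) s i z.
have thP j z : (j <= n)%N -> angle_of (w j z) (th j z).
  elim: j => [_|j IHj jn].
    by rewrite /th big_ord0 addr0 /w !mul0r.
  rewrite /th big_ord_recr /= addrA /s jn.
  by apply: angle_rotate; [apply: IHj; exact: ltnW|exact: dw].
have clamp0 : clamp k 0 = 0 by rewrite clamp_id// normr0 ltW.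
exists (th n); split.
- rewrite /th; apply: fun_continuousD; first exact: fun_continuous_cst.
  exact: fun_continuous_sum.
- move=> z z1 z2; have := thP n z (leqnn n).
  rewrite /w divff ?pnatr_eq0 -?lt0n// !mul1r !clamp_id//.
  by case: z {z1 z2}.
rewrite /th big1 ?addr0// => i _; rewrite /s ltn_ord /w /= !clamp0 !mulr0.
by rewrite (_ : cross _ _ = 0) ?mul0r ?atan0// /cross mulrC subrr.
Qed.

Lemma angle_lift (W : R * R -> R * R) : continuous W ->
  (forall z, W z != (0, 0)) ->
  exists2 th : R * R -> R, continuous th & forall z, angle_of (W z) (th z).
Proof.
move=> cW W0; have [t0 a0] := angle_exists (W0 (0, 0)).
have /choice[th thP] (n : nat) : exists th : R * R -> R, [/\ continuous th,
    forall z, `|z.1| <= n.+1%:R -> `|z.2| <= n.+1%:R -> angle_of (W z) (th z) &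
    th (0, 0) = t0].
  exact: angle_lift_box.
have agree n m z : (n <= m)%N -> `|z.1| <= n.+1%:R -> `|z.2| <= n.+1%:R ->
    th n z = th m z.
  move=> nm z1 z2; have [cn an n0] := thP n; have [cm am m0] := thP m.
  pose d t := th n (t * z.1, t * z.2) - th m (t * z.1, t * z.2).
  have cd : continuous d by rewrite /d; cont.
  have : d 1 = d 0.
    apply: cos_eq1_path => // t /andP[t0' t1]; apply: angle_cos_eq1.
    have h x : `|x| <= n.+1%:R -> `|t * x| <= n.+1%:R.
      by move=> xn; rewrite normrM ger0_norm//; apply: le_trans xn; apply: ler_piMl.
    + by apply: an; exact: h.
    have h x : `|x| <= n.+1%:R -> `|t * x| <= m.+1%:R.
      move=> xn; rewrite normrM ger0_norm//; apply: (@le_trans _ _ `|x|).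
        exact: ler_piMl.
      by rewrite (le_trans xn)// ler_nat.
    + by apply: am; exact: h.
  rewrite /d !mul0r !mul1r n0 m0 subrr => /eqP; rewrite subr_eq0 => /eqP.
  by case: z {z1 z2 d cd}.
(* The value at [z] is taken from the box numbered [N z]. Near [z0] these boxes are no larger than
   the one of [z0], so by [agree] the result coincides there with the continuous [th (N z0)]. *)
pose N z := Num.truncn (`|z.1| + `|z.2|).
have bN n z : `|z.1| + `|z.2| < n.+1%:R -> `|z.1| <= n.+1%:R /\ `|z.2| <= n.+1%:R.
  move=> h; have := normr_ge0 z.1; have := normr_ge0 z.2; split; lra.
have NS z : `|z.1| + `|z.2| < (N z).+1%:R by exact: truncnS_gt.
exists (fun z => th (N z) z); last first.
  by move=> z; have [_ + _] := thP (N z); apply; have [] := bN _ _ (NS z).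
move=> z0.
have cm : continuous (fun z : R * R => `|z.1| + `|z.2|).
  by cont.
have nz : \forall z \near z0, `|z.1| + `|z.2| < (N z0).+1%:R.
  have := cm z0; move/cvgr_lt; apply; exact: NS.
have [c0 _ _] := thP (N z0).
apply: cvg_trans (c0 z0).
apply: near_eq_cvg; near=> z.
have zz : `|z.1| + `|z.2| < (N z0).+1%:R by near: z.
apply/esym/agree.
- by rewrite /N truncn_le_nat.
- by have [] := bN _ _ (NS z).
- by have [] := bN _ _ (NS z).
Unshelve. all: by end_near. Qed.

End AngleLift.

(** * The rotation along an orbit that crosses the strip *)

Section AngleSigns.
Context {R : realType}.
Implicit Types (a : R * R) (t : R).

Lemma angle_sin_ge0 a t : angle_of a t -> (0 <= sin t) = (0 <= a.2).
Proof. by move=> [r r0 ->] /=; rewrite pmulr_rge0. Qed.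

Lemma angle_sin_gt0 a t : angle_of a t -> (0 < sin t) = (0 < a.2).
Proof. by move=> [r r0 ->] /=; rewrite pmulr_rgt0. Qed.

Lemma angle_cos_sgn a t : angle_of a t -> (0 < cos t) = (0 < a.1).
Proof. by move=> [r r0 ->] /=; rewrite pmulr_rgt0. Qed.

Lemma angle_cos_lt0 a t : angle_of a t -> (cos t < 0) = (a.1 < 0).
Proof. by move=> [r r0 ->] /=; rewrite pmulr_rlt0. Qed.

Lemma cos_eq1B s t : cos s = 1 -> cos t = 1 -> cos (s - t) = 1 :> R.
Proof.
move=> cs ct; have := cos2Dsin2 t; rewrite ct expr1n => /eqP.
rewrite -subr_eq0 addrAC subrr add0r sqrf_eq0 => /eqP st.
by rewrite cosB cs ct st !mulr0 addr0 mulr1.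
Qed.

(** For [d] the difference of the angles of two vectors that always form an acute angle and have the
    same direction at both ends: they rotate by the same amount. *)
Lemma cos_eq1_ends (d : R -> R) (a b : R) : continuous d -> a <= b ->
  (forall t, a <= t <= b -> 0 < cos (d t)) ->
  cos (d a) = 1 -> cos (d b) = 1 -> d b = d a.
Proof.
move=> cd ab dp da db; apply/eqP; rewrite -subr_eq0; apply/eqP/cos_eq1_small.
  exact: cos_eq1B.
have pi0 := @pi_gt0 R.
by apply: lt_trans (cos_gt0_path cd ab dp da) _; lra.
Qed.

End AngleSigns.

Section Index.
Context {R : realType}.
Implicit Types (z : R * R) (t : R).

Definition disp (F : R * R -> R * R) z : R * R := ((F z).1 - z.1, (F z).2 - z.2).

Lemma disp_neq0 (F : R * R -> R * R) z : F z != z -> disp F z != (0, 0).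
Proof.
apply: contra_neq; rewrite /disp; case: z (F z) => x y [u v] /= [/eqP + /eqP].
by rewrite !subr_eq0 => /eqP -> /eqP ->.
Qed.

Lemma disp_continuous (F : R * R -> R * R) : continuous F -> continuous (disp F).
Proof. by move=> cF; rewrite /disp; cont. Qed.

Definition clamp01 t : R := Num.max 0 (Num.min t 1).

Lemma clamp01_continuous : continuous clamp01.
Proof. by rewrite /clamp01; cont. Qed.

Lemma clamp01_id t : 0 <= t <= 1 -> clamp01 t = t.
Proof. by move=> /andP[t0 t1]; rewrite /clamp01 min_l// max_r. Qed.

Lemma clamp01_ge1 t : 1 <= t -> clamp01 t = 1.
Proof. by move=> t1; rewrite /clamp01 min_r// max_r. Qed.

Lemma clamp01_le0 t : t <= 0 -> clamp01 t = 0.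
Proof. by move=> t0; rewrite /clamp01 max_l// ge_min t0. Qed.

Lemma clamp01_itv t : 0 <= clamp01 t <= 1.
Proof. by rewrite /clamp01 le_max lexx ge_max ler01 ge_min lexx orbT. Qed.

(* Extends a path [b] from [b 0] to [b 1 = G (b 0)] to the parameters from 0 to
   [n + 1] by the equation [g (t + 1) = G (g t)]. Of the two terms involving
   [t], one is constant and cancels with [b 1], on either side of [t = 1]. *)
Fixpoint orbit_path (G : R * R -> R * R) (b : R -> R * R) (n : nat) t : R * R :=
  if n is n'.+1 then
    ((b (Num.min t 1)).1 + (G (orbit_path G b n' (Num.max t 1 - 1))).1 - (b 1).1,
     (b (Num.min t 1)).2 + (G (orbit_path G b n' (Num.max t 1 - 1))).2 - (b 1).2)
  else b (Num.min t 1).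

Section OrbitPath.
Variables (G : R * R -> R * R) (b : R -> R * R).
Hypotheses (cG : continuous G) (cb : continuous b) (b1 : b 1 = G (b 0)).

Lemma orbit_path_continuous n : continuous (orbit_path G b n).
Proof. by elim: n => [|n IHn] /=; cont. Qed.

Lemma orbit_path_init n t : t <= 1 -> orbit_path G b n t = b t.
Proof.
elim: n t => [|n IHn] t t1 /=; first by rewrite min_l.
rewrite (min_l t1) (max_r t1) subrr IHn ?ler01// b1 !addrK.
by case: (b t).
Qed.

Lemma orbit_path_succ n t : 0 <= t ->
  orbit_path G b n.+1 (t + 1) = G (orbit_path G b n t).
Proof.
move=> t0 /=; have t1 : 1 <= t + 1 by rewrite lerDr.
rewrite (min_r t1) (max_l t1) addrK [(b 1).1 + _]addrC [(b 1).2 + _]addrC !addrK.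
by case: (G _).
Qed.

(** This turns [orbit_path_succ], which relates two levels of the recursion, into the equation
    [g (t + 1) = G (g t)] for a single path. *)
Lemma orbit_path_stable n t : t <= n.+1%:R ->
  orbit_path G b n.+1 t = orbit_path G b n t.
Proof.
elim: n t => [|n IHn] t tn.
  by rewrite !orbit_path_init.
have [t1|t1] := leP t 1; first by rewrite !orbit_path_init.
rewrite -(subrK 1 t) !orbit_path_succ ?subr_ge0 ?(ltW t1)// IHn//.
by rewrite lerBlDr natr1.
Qed.

End OrbitPath.

Section IndexOfOrbit.
Variables (G F : R * R -> R * R) (g0 g1 : R -> R) (p : R * R) (N : nat).
Hypotheses (cG : continuous G) (injG : injective G).
Hypotheses (g0_surj : forall x, exists x', g0 x' = x) (g0_lt : forall x, g0 x < x).
Hypotheses (g1_gt : forall x, x < g1 x).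
Hypotheses (Gbot : forall x y : R, y <= - 1 -> G (x, y) = (g0 x, y / 2)).
Hypotheses (Gtop : forall x y : R, 2 <= y -> G (x, y) = (g1 x, y *+ 2 - 1)).
Hypotheses (Fbot : forall x y : R, y <= - 1 -> F (x, y) = (g0 x, y / 2)).
Hypotheses (Ftop : forall x y : R, 2 <= y -> F (x, y) = (g1 x, y *+ 2 - 1)).
Hypotheses (p_bot : p.2 <= - 2) (p_top : 2 <= (iter N G p).2).
Hypotheses (GF : forall z, 0 < dot (disp G z) (disp F z)).

(** Surjectivity of [g0] makes [G] map the half plane below [y0] onto the one below [y0 / 2]; by
    injectivity no other point lands there. *)
Lemma above_bottom y0 z : y0 <= - 1 -> y0 <= z.2 -> y0 / 2 <= (G z).2.
Proof.
move=> y1 yz; rewrite leNgt; apply/negP => h.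
have [x' x'E] := g0_surj (G z).1.
have : G (x', (G z).2 * 2) = G z.
  by rewrite Gbot; [rewrite x'E mulfK ?pnatr_eq0//; case: (G z)|lra].
by move/injG => e; move: yz; rewrite -e /= leNgt => /negP; apply; lra.
Qed.

(** The chords of the path link the diagonal of a triangle of parameters, where they are
    displacements of [G], to its other two sides, where they point upwards. The displacement is not
    horizontal at [zb] and [zt], hence bounds instead of the exact value. *)
Lemma index_of_orbit (th : R * R -> R) : continuous th ->
  (forall z, angle_of (disp F z) (th z)) ->
  exists zb zt : R * R, [/\ zb.2 <= - 2, 2 <= zt.2 & - pi < th zt - th zb < 0].
Proof.
move=> cth thP.
pose y0 := p.2.
(* The straight segment from [p] to [G p], whose height is [y0 / 2]. *)
pose b t := ((1 - t) * p.1 + t * (G p).1, y0 * (1 - t / 2)).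
have GpE : G p = (g0 p.1, y0 / 2).
  by rewrite {1}(surjective_pairing p) Gbot//; move: p_bot; lra.
have b0 : b 0 = p.
  rewrite /b subr0 !mul0r mul1r addr0 subr0 mulr1 /y0; by case: p.
have b1 : b 1 = G (b 0).
  rewrite b0 /b subrr mul0r add0r !mul1r [RHS]surjective_pairing; congr pair.
  by rewrite GpE /=; field.
have cb : continuous b by rewrite /b; cont.
have [g [cg g_init g_succ]] : exists g : R -> R * R, [/\ continuous g,
    forall t, t <= 1 -> g t = b t &
    forall t, 0 <= t -> t <= N.+1%:R -> g (t + 1) = G (g t)].
  exists (orbit_path G b N.+1); split.
  - exact: orbit_path_continuous.
  - by move=> t; exact: orbit_path_init.
  - by move=> t t0 tN; rewrite orbit_path_succ// orbit_path_stable.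
have g_nat k : (k <= N)%N -> g k%:R = iter k G p.
  elim: k => [_|k IHk kN]; first by rewrite g_init// b0.
  by rewrite -natr1 g_succ ?ler_nat 1?ltnW// ?IHk// ltnW // ltnW.
have y0_lt : y0 <= - 2 by exact: p_bot.
have g_ge t : 0 <= t -> t <= N.+1%:R + 1 -> y0 <= (g t).2.
  have [n tn] : exists n, t <= n.+1%:R.
    by exists (Num.truncn t); rewrite ltW// truncnS_gt.
  elim: n t tn => [|n IHn] t tn t0 tN.
    rewrite g_init//= mulrBr mulr1 lerBrDr gerDl mulrA pmulr_lle0 ?invr_gt0//.
    by rewrite mulr_le0_ge0//; lra.
  have [t1|t1] := leP t 1; first by apply: IHn; rewrite // (le_trans t1)// ler1n.
  rewrite -(subrK 1 t) g_succ; [|lra|lra].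
  apply: (@le_trans _ _ (y0 / 2)); first by lra.
  apply: above_bottom; first by lra.
  apply: IHn; [|lra|lra].
  by rewrite lerBlDr natr1.
have g_ge1 t : 1 <= t -> t <= N.+1%:R + 1 -> y0 / 2 <= (g t).2.
  move=> t1 tN; rewrite -(subrK 1 t) g_succ; [|lra|lra].
  by apply: above_bottom; [lra|apply: g_ge; lra].
(* Injectivity of [G] lowers both parameters by 1 until [s < 1]. Then [g s] lies strictly below the
   height [y0 / 2], and [g t] does not. *)
have g_neq (s t : R) : 0 <= s -> s + 1 <= t -> t <= N.+1%:R + 1 -> g s != g t.
  have [n sn] : exists n, s < n.+1%:R.
    by exists (Num.truncn s); rewrite truncnS_gt.
  elim: n s t sn => [|n IHn] s t sn s0 st tN.
    apply/eqP => /(congr1 snd) /eqP; rewrite lt_eqF//.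
    apply: lt_le_trans (g_ge1 t _ _); [|lra|exact: tN].
    rewrite g_init ?ltW//=.
    by rewrite ltr_nM2l; lra.
  have [s1|s1] := ltP s 1.
    by apply: IHn => //; rewrite (lt_le_trans s1)// ler1n.
  rewrite -(subrK 1 s) -(subrK 1 t) !g_succ; [|lra|lra|lra|lra].
  apply/eqP => /injG; apply/eqP; apply: IHn; [|lra|lra|lra].
  by rewrite ltrBlDr natr1.
(* The path is cut at a highest point rather than at time [N], so that no chord ending at
   [g (ts + 1)] points downwards. *)
have [ts] : exists2 ts : R, ts \in `[0, N%:R]%R &
    forall t, t \in `[0, N%:R]%R -> (g t).2 <= (g ts).2.
  apply: (@EVT_max R (fun t => (g t).2)); first by [].
  by apply: continuous_subspaceT; cont.
rewrite in_itv /= => /andP[ts0 tsN] ts_max.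
set ys := (g ts).2 in ts_max.
have ys2 : 2 <= ys.
  apply: le_trans (ts_max N%:R _); last by rewrite in_itv /= lexx ler0n.
  by have := p_top; rewrite -g_nat.
have NS : N.+1%:R = N%:R + 1 :> R by rewrite natr1.
have gts1 : g (ts + 1) = (g1 (g ts).1, ys *+ 2 - 1).
  rewrite g_succ//; last by lra.
  by rewrite {1}(surjective_pairing (g ts)) Gtop.
pose c := clamp01; have cc : continuous c := clamp01_continuous.
(* The chord from [g (ts * a)] to [g (1 + ts * b)] for [a <= b], symmetrized. *)
pose W z := ((g (1 + ts * Num.max (c z.1) (c z.2))).1 -
               (g (ts * Num.min (c z.1) (c z.2))).1,
             (g (1 + ts * Num.max (c z.1) (c z.2))).2 -
               (g (ts * Num.min (c z.1) (c z.2))).2).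
have cW : continuous W by rewrite /W; cont.
have W0 z : W z != (0, 0).
  have /andP[c10 c11] := clamp01_itv z.1; have /andP[c20 c21] := clamp01_itv z.2.
  have := @g_neq (ts * Num.min (c z.1) (c z.2)) (1 + ts * Num.max (c z.1) (c z.2)).
  have m0 : 0 <= Num.min (c z.1) (c z.2) by rewrite le_min; apply/andP.
  have m1 : Num.max (c z.1) (c z.2) <= 1 by rewrite ge_max; apply/andP.
  have mm : Num.min (c z.1) (c z.2) <= Num.max (c z.1) (c z.2).
    by case: (leP (c z.1) (c z.2)) => // /ltW.
  have h1 : ts * Num.min (c z.1) (c z.2) <= ts * Num.max (c z.1) (c z.2).
    exact: ler_wpM2l.
  have h2 : ts * Num.max (c z.1) (c z.2) <= ts by apply: ler_piMr.
  move=> /(_ (mulr_ge0 ts0 m0) ltac:(lra) ltac:(lra)).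
  apply: contra_neq; rewrite /W => -[/eqP + /eqP]; rewrite !subr_eq0.
  move=> /eqP e1 /eqP e2.
  by rewrite [LHS]surjective_pairing [RHS]surjective_pairing e1 e2.
have [Th cTh ThP] := angle_lift cW W0.
have c0 : c 0 = 0 by rewrite /c clamp01_id// lexx ler01.
have c1 : c 1 = 1 by rewrite /c clamp01_id// lexx ler01.
have Wdiag t : 0 <= t <= 1 -> W (t, t) = disp G (g (ts * t)).
  move=> /andP[t0 t1]; rewrite /W /= maxxx minxx /c clamp01_id ?t0//.
  rewrite /disp (addrC 1) -g_succ//; first exact: mulr_ge0.
  have : ts * t <= ts by apply: ler_piMr.
  lra.
have W00 : W (0, 0) = disp F (g 0).
  rewrite Wdiag ?lexx ?ler01// mulr0 /disp g_init// b0.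
  suff -> : G p = F p by [].
  rewrite (surjective_pairing p) Gbot; last by move: p_bot; lra.
  by rewrite Fbot//; move: p_bot; lra.
have W11 : W (1, 1) = disp F (g ts).
  rewrite Wdiag ?lexx ?ler01// mulr1 /disp.
  suff -> : G (g ts) = F (g ts) by [].
  by rewrite (surjective_pairing (g ts)) Gtop ?Ftop.
have edge : `|Th (1, 1) - Th (0, 0)| <= pi.
  (* The parameters run from [(0, 0)] through [(0, 1)] to [(1, 1)]: the chords first all start at
     [g 0], then all end at [g (ts + 1)]. *)
  pose d t := Th (c (t - 1), c t).
  have cd : continuous d by rewrite /d; cont.
  have d2 : d 2 = Th (1, 1) by rewrite /d /c !clamp01_ge1//; lra.
  have d0 : d 0 = Th (0, 0) by rewrite /d /c !clamp01_le0//; lra.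
  rewrite -d2 -d0; apply: sin_ge0_path => // t /andP[t0 t2].
  rewrite (angle_sin_ge0 (ThP _)) /W /= subr_ge0.
  have [t1|t1] := leP t 1.
    rewrite /c (@clamp01_le0 (t - 1)); last by lra.
    rewrite (@clamp01_id t) ?t0// clamp01_id ?lexx ?ler01// (clamp01_id (t := t)) ?t0//.
    rewrite max_r// min_l// mulr0.
    have h : ts * t <= ts by apply: ler_piMr.
    have h0 : 0 <= ts * t by apply: mulr_ge0.
    apply: le_trans (g_ge1 _ _ _); [|lra|lra].
    rewrite g_init// b0 -/y0; lra.
  rewrite /c (clamp01_ge1 (ltW t1)) (@clamp01_id (t - 1)); last by lra.
  rewrite (@clamp01_ge1 1)// clamp01_id; last by lra.
  rewrite max_r; last by lra.
  rewrite min_l; last by lra.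
  rewrite mulr1 (addrC 1 ts) gts1 /=.
  apply: (@le_trans _ _ ys); last by lra.
  apply: ts_max; rewrite in_itv /= mulr_ge0//=; last by lra.
  by apply: le_trans tsN; apply: ler_piMr => //; lra.
have [C0 S0] : cos (Th (0, 0)) < 0 /\ 0 < sin (Th (0, 0)).
  rewrite (angle_cos_lt0 (ThP _)) (angle_sin_gt0 (ThP _)) W00 /disp g_init// b0.
  have -> : F p = (g0 p.1, y0 / 2).
    by rewrite {1}(surjective_pairing p) Fbot//; move: p_bot; lra.
  by rewrite /= subr_lt0 -/y0; split => //; lra.
have [C1 S1] : 0 < cos (Th (1, 1)) /\ 0 < sin (Th (1, 1)).
  rewrite (angle_cos_sgn (ThP _)) (angle_sin_gt0 (ThP _)) W11 /disp.
  have -> : F (g ts) = (g1 (g ts).1, ys *+ 2 - 1).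
    by rewrite {1}(surjective_pairing (g ts)) Ftop.
  by rewrite /= subr_gt0 -/ys; split => //; lra.
(* The chord turns from the upper left to the upper right quadrant, so the sine of the rotation is
   negative; [edge] excludes further turns. *)
have rot : - pi < Th (1, 1) - Th (0, 0) < 0.
  have sneg : sin (Th (1, 1) - Th (0, 0)) < 0.
    by rewrite sinB; nra.
  move: edge; rewrite ler_norml => /andP[e1 e2]; apply/andP; split.
    rewrite lt_neqAle e1 andbT; apply/eqP => e; move: sneg.
    by rewrite -e sinN sinpi oppr0 ltxx.
  rewrite ltNge; apply/negP => e0; move: sneg; apply/negP; rewrite -leNgt.
  by apply: sin_ge0_pi; rewrite e0.
(* On the diagonal the chord is the displacement of [G], which forms an acute angle with that of [F]
   and equals it at both ends. *)
have : Th (1, 1) - th (g (ts * 1)) = Th (0, 0) - th (g (ts * 0)).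
  pose d t := Th (t, t) - th (g (ts * t)).
  have cd : continuous d by rewrite /d; cont.
  apply: (@cos_eq1_ends _ d) => //.
  - move=> t t01; apply: (angle_cos_gt0 (ThP _) (thP _)).
    by rewrite Wdiag.
  - by apply: (angle_cos_eq1 (ThP _)); rewrite W00 mulr0; exact: thP.
  - by apply: (angle_cos_eq1 (ThP _)); rewrite W11 mulr1; exact: thP.
rewrite mulr0 mulr1 => dE; exists (g 0), (g ts); split.
- by rewrite g_init// b0.
- exact: ys2.
- by have <- : Th (1, 1) - Th (0, 0) = th (g ts) - th (g 0) by lra.
Qed.

End IndexOfOrbit.
End Index.

(** * Pushing points inside disjoint boxes *)

Section Push.
Context {R : realType}.
Implicit Types (l h a b z : R * R).

Definition in_box l h z := (l.1 < z.1 < h.1) && (l.2 < z.2 < h.2).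

(* The gauge (Minkowski functional) of the interval ]l, h[ with origin [a]. *)
Definition gauge1 (l h a x : R) : R :=
  Num.max ((x - a) / (h - a)) ((a - x) / (a - l)).

Definition gauge l h a z : R :=
  Num.max (gauge1 l.1 h.1 a.1 z.1) (gauge1 l.2 h.2 a.2 z.2).

(* Moves the apex of the cone over the boundary of the box from [a] to [b]: the
   point at gauge [s] from [a] goes to the point at gauge [s] from [b] that is
   over the same boundary point. *)
Definition push l h a b z : R * R :=
  (z.1 + Num.max 0 (1 - gauge l h a z) * (b.1 - a.1),
   z.2 + Num.max 0 (1 - gauge l h a z) * (b.2 - a.2)).

Lemma gauge1_le (l h a b x s : R) : l < a < h -> l < b < h ->
  gauge1 l h a x <= s -> gauge1 l h b (x + (1 - s) * (b - a)) <= s.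
Proof.
move=> /andP[la ah] /andP[lb bh]; rewrite /gauge1 !ge_max.
by rewrite !ler_pdivrMr ?subr_gt0// => /andP[h1 h2]; apply/andP; split; lra.
Qed.

Lemma gauge1_eq (l h a b x s : R) : l < a < h -> l < b < h ->
  gauge1 l h a x = s -> gauge1 l h b (x + (1 - s) * (b - a)) = s.
Proof.
move=> ab bb e; apply/le_anti; rewrite gauge1_le ?e//=.
move: ab bb => /andP[la ah] /andP[lb bh].
move: e; rewrite /gauge1 le_max !ler_pdivlMr ?subr_gt0//.
have ah0 : h - a != 0 by rewrite subr_eq0 gt_eqF.
have la0 : a - l != 0 by rewrite subr_eq0 gt_eqF.
case: (leP ((x - a) / (h - a))) => _ e; apply/orP; [right|left].
  have : a - x = s * (a - l) by rewrite -e divfK.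
  lra.
have : x - a = s * (h - a) by rewrite -e divfK.
lra.
Qed.

(** A point at gauge [s] is [a + s (w - a)] with [w] on the boundary of the box, and adding
    [(1 - s) (b - a)] gives [b + s (w - b)]. *)
Lemma gauge_move l h a b z s : in_box l h a -> in_box l h b ->
  gauge l h a z = s ->
  gauge l h b (z.1 + (1 - s) * (b.1 - a.1), z.2 + (1 - s) * (b.2 - a.2)) = s.
Proof.
move=> /andP[a1 a2] /andP[b1 b2]; rewrite /gauge /=.
case: (leP (gauge1 _ _ a.1 _)) => [h1 e|/ltW h1 e].
  rewrite max_r; first exact: gauge1_eq.
  by rewrite (gauge1_eq a2 b2 e) gauge1_le// -e.
rewrite max_l; first exact: gauge1_eq.
by rewrite (gauge1_eq a1 b1 e) gauge1_le// -e.
Qed.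

Lemma gauge_lt1 l h a z : in_box l h a -> (gauge l h a z < 1) = in_box l h z.
Proof.
move=> /andP[/andP[a1 a2] /andP[a3 a4]].
rewrite /gauge /gauge1 !gt_max !ltr_pdivrMr ?subr_gt0// !mul1r /in_box.
by rewrite !ltrD2r !ltrD2l !ltrN2 [(z.1 < _) && _]andbC [(z.2 < _) && _]andbC.
Qed.

Lemma gauge_id l h a : gauge l h a a = 0.
Proof. by rewrite /gauge /gauge1 !subrr !mul0r !maxxx. Qed.

Lemma push_out l h a b z : in_box l h a -> ~~ in_box l h z -> push l h a b z = z.
Proof.
move=> al zl; rewrite /push max_l; first by rewrite !mul0r !addr0; case: z {zl}.
by rewrite subr_le0 leNgt gauge_lt1.
Qed.

Lemma push_in l h a b z : in_box l h a -> in_box l h z ->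
  push l h a b z = (z.1 + (1 - gauge l h a z) * (b.1 - a.1),
                    z.2 + (1 - gauge l h a z) * (b.2 - a.2)).
Proof.
by move=> al zl; rewrite /push max_r// subr_ge0 ltW// gauge_lt1.
Qed.

Lemma push_in_box l h a b z : in_box l h a -> in_box l h b -> in_box l h z ->
  in_box l h (push l h a b z).
Proof.
move=> al bl zl; rewrite push_in// -(gauge_lt1 _ bl).
by rewrite (gauge_move al bl erefl) gauge_lt1.
Qed.

Lemma push_apex l h a b : in_box l h a -> push l h a b a = b.
Proof.
move=> al; rewrite push_in// gauge_id subr0 !mul1r [RHS]surjective_pairing.
by congr pair; ring.
Qed.

Lemma pushK l h a b : in_box l h a -> in_box l h b ->
  cancel (push l h a b) (push l h b a).
Proof.
move=> al bl z; have [zl|zl] := boolP (in_box l h z); last first.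
  by rewrite (push_out _ al)// push_out.
rewrite (@push_in _ _ b a)//; last exact: push_in_box.
rewrite (push_in _ al)// (gauge_move al bl erefl) [RHS]surjective_pairing /=.
by congr pair; ring.
Qed.

Lemma push_continuous l h a b : in_box l h a -> continuous (push l h a b).
Proof. by move=> al; rewrite /push /gauge /gauge1; cont. Qed.

(** Each push is the identity outside its own box, so pushes in disjoint boxes compose without
    interfering. *)
Lemma push_family (l h a b : nat -> R * R) n :
  (forall i, (i < n)%N -> in_box (l i) (h i) (a i) && in_box (l i) (h i) (b i)) ->
  (forall i j z, (i < n)%N -> (j < n)%N -> in_box (l i) (h i) z ->
    in_box (l j) (h j) z -> i = j) ->
  exists P : R * R -> R * R,
  [/\ continuous P, injective P, forall i, (i < n)%N -> P (a i) = b i,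
      forall z, (forall i, (i < n)%N -> ~~ in_box (l i) (h i) z) -> P z = z &
      forall i z, (i < n)%N -> in_box (l i) (h i) z -> in_box (l i) (h i) (P z)].
Proof.
elim: n => [|n IHn] ab disj.
  by exists id; split=> // x; exact: cvg_id.
have [||P [cP injP Pab Pout Pin]] := IHn.
- by move=> i ni; apply: ab; exact: ltnW.
- by move=> i j z ni nj; apply: disj; exact: ltnW.
have /andP[an bn] := ab n (ltnSn n).
have out i z : (i < n)%N -> in_box (l i) (h i) z -> ~~ in_box (l n) (h n) z.
  move=> ni zi; apply/negP => zn.
  by move: (ni); rewrite (disj i n z _ _ zi zn) ?ltnn// ltnW.
have out' i z : (i < n)%N -> in_box (l n) (h n) z -> ~~ in_box (l i) (h i) z.
  by move=> ni zn; apply/negP => /(out _ _ ni); rewrite zn.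
exists (push (l n) (h n) (a n) (b n) \o P); split.
- move=> z; apply: continuous_comp; first exact: cP.
  exact: push_continuous.
- by apply: inj_comp => //; apply: can_inj (pushK an bn).
- move=> i; rewrite ltnS leq_eqVlt => /orP[/eqP ->|ni] /=.
    by rewrite Pout ?push_apex// => k kn; exact: out'.
  by rewrite Pab// push_out// (out i)//; have /andP[] := ab i (ltnW ni).
- move=> z zout /=; rewrite Pout; last by move=> i ni; apply: zout; exact: ltnW.
  by rewrite push_out// zout.
- move=> i z; rewrite ltnS leq_eqVlt => /orP[/eqP ->|ni] zi /=.
    by rewrite Pout; [exact: push_in_box|move=> i' ni; exact: out'].
  have zP : in_box (l i) (h i) (P z) by exact: Pin.
  by rewrite push_out//; exact: out zP.
Qed.

End Push.

(** * Simple closed walks on the boundary of a set of cells *)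

Section GridWalk.
Variable n : nat.
Local Notation m := (n.+1)%N.
Variable A : int -> int -> bool.
Hypothesis A_bot : forall j i : int, i <= 0 -> A j i.
Hypothesis A_top : forall j i : int, m%:Z <= i -> ~~ A j i.
Hypothesis A_per : forall j i : int, A (j + m%:Z) i = A j i.
Implicit Types (i j : int) (v : int * int).

(* East, north, west and south are [(false, false)], [(true, false)],
   [(false, true)] and [(true, true)]. *)
Definition dir : finType := (bool * bool)%type.
Definition turn_left (d : dir) : dir := (~~ d.1, d.1 (+) d.2).
Definition turn_right (d : dir) : dir := (~~ d.1, ~~ (d.1 (+) d.2)).
Definition dx (d : dir) : int := if d.1 then 0 else if d.2 then -1 else 1.
Definition dy (d : dir) : int := if d.1 then if d.2 then -1 else 1 else 0.

(* The vertex [(j, i)] is the lower left corner of the cell [(j, i)]. The four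
   cells around a vertex are labelled by directions, the north-east one by east,
   so that an edge entering [v] in direction [d] has [cell v (turn_left d)] on
   its left and [cell v (turn_left (turn_left d))] on its right. *)
Definition cell v (d : dir) : bool :=
  A (if d.1 (+) d.2 then v.1 - 1 else v.1) (if d.2 then v.2 - 1 else v.2).

Definition boundary v (d : dir) : bool :=
  cell v (turn_left d) && ~~ cell v (turn_left (turn_left d)).

Definition target v (d : dir) : int * int := (v.1 + dx d, v.2 + dy d).

(* Follows the boundary of [A], keeping [A] on the left. *)
Definition next_dir v (d : dir) : dir :=
  if ~~ cell v d then turn_left d
  else if ~~ cell v (turn_right d) then d else turn_right d.

Definition next_dart (e : int * int * dir) : int * int * dir :=
  let d := next_dir e.1 e.2 in (target e.1 d, d).

Lemma next_boundary v d : boundary v d ->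
  boundary (next_dart (v, d)).1 (next_dart (v, d)).2.
Proof.
case: v d => j i [[] []]; rewrite /next_dart /next_dir /boundary /cell /target /dx /dy /=;
  case E1: (A j i); case E2: (A (j - 1) i); case E3: (A (j - 1) (i - 1));
  case E4: (A j (i - 1)) => //= _;
  by rewrite ?addr0 ?addrK ?subrK ?E1 ?E2 ?E3 ?E4.
Qed.

(** Equal images have the same start vertex, and a case check on the four cells around it recovers
    the incoming direction. *)
Lemma next_dart_inj v1 v2 d1 d2 : boundary v1 d1 -> boundary v2 d2 ->
  next_dart (v1, d1) = next_dart (v2, d2) -> (v1, d1) = (v2, d2).
Proof.
move=> b1 b2 [/= e1 e2 e3]; move: e1 e2; rewrite e3 => /addIr e1 /addIr e2.
have e : v1 = v2 by rewrite [v1]surjective_pairing [v2]surjective_pairing e1 e2.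
rewrite {}e {e1 e2} in b1 e3 *; congr pair; move: b1 b2 e3.
rewrite /boundary /next_dir /cell.
case: d1 d2 => [[] []] [[] []] //=;
  case: (A v2.1 v2.2); case: (A (v2.1 - 1) v2.2) => //=;
  case: (A (v2.1 - 1) (v2.2 - 1)); case: (A v2.1 (v2.2 - 1)) => //=.
Qed.

Lemma boundary_row v d : boundary v d -> 1 <= v.2 <= m%:Z.
Proof.
move=> bv; apply/andP; split; rewrite leNgt; apply/negP => h.
  by move: bv; rewrite /boundary /cell A_bot ?A_bot ?andbF//; case: ifP => _; lia.
move: bv; rewrite /boundary /cell (negbTE (A_top _ _))//; case: ifP => _; lia.
Qed.

Lemma A_perM j i (u : int) : A (j + u * m%:Z) i = A j i.
Proof.
have nat_case (k : nat) j' : A (j' + k%:Z * m%:Z) i = A j' i.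
  elim: k j' => [|k IHk] j'; first by rewrite mul0r addr0.
  by rewrite -addn1 PoszD mulrDl mul1r addrA A_per IHk.
case: u => k; first exact: nat_case.
by rewrite NegzE mulNr -[LHS](nat_case k.+1) subrK.
Qed.

Definition shift v (u : int) : int * int := (v.1 + u * m%:Z, v.2).

Lemma cell_shift v u d : cell (shift v u) d = cell v d.
Proof. by rewrite /cell /shift /=; case: ifP => _; rewrite ?[_ - 1]addrAC A_perM. Qed.

Lemma boundary_shift v u d : boundary (shift v u) d = boundary v d.
Proof. by rewrite /boundary !cell_shift. Qed.

Lemma next_shift v u d : next_dart (shift v u, d) =
  (shift (next_dart (v, d)).1 u, (next_dart (v, d)).2).
Proof.
by rewrite /next_dart /next_dir /= !cell_shift /target /shift /= addrAC.
Qed.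

(* Darts modulo the horizontal period; rows 0 to [m] contain all the boundary. *)
Definition dart : finType := ('I_m * 'I_m.+1 * dir)%type.
Definition lift_dart (x : dart) : int * int * dir :=
  ((x.1.1 : nat)%:Z, (x.1.2 : nat)%:Z, x.2).
Definition reduce (e : int * int * dir) : dart :=
  (inord `|(e.1.1 %% m%:Z)%Z|%N, inord `|e.1.2|%N, e.2).

Lemma lift_reduce e : 0 <= e.1.2 <= m%:Z ->
  exists u, lift_dart (reduce e) = (shift e.1 u, e.2).
Proof.
case: e => [[j i] d] /= /andP[i0 im]; exists (- (j %/ m%:Z)%Z).
rewrite /lift_dart /reduce /shift /= !inordK.
- by rewrite !gez0_abs ?modz_ge0//; congr (_, _, _); rewrite /modz; lia.
- lia.
- have := modz_ge0 j (isT : m%:Z != 0); have := ltz_pmod j (isT : 0 < m%:Z); lia.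
Qed.

Definition valid (x : dart) : bool := boundary (lift_dart x).1 (lift_dart x).2.
(** Fixing the darts that are not valid makes this a permutation of the whole finite type. *)
Definition step (x : dart) : dart :=
  if valid x then reduce (next_dart (lift_dart x)) else x.

Lemma lift_step x : valid x ->
  exists u, lift_dart (step x) =
    (shift (next_dart (lift_dart x)).1 u, (next_dart (lift_dart x)).2).
Proof.
move=> vx; rewrite /step vx; apply: lift_reduce.
have := next_boundary vx; rewrite -surjective_pairing => /boundary_row.
by case/andP => h ->; rewrite andbT; exact: le_trans h.
Qed.

Lemma valid_step x : valid (step x) = valid x.
Proof.
have [vx|vx] := boolP (valid x); last by rewrite /step (negbTE vx) (negbTE vx).
have [u uE] := lift_step vx.
rewrite /valid uE /= boundary_shift.
by have := next_boundary vx; rewrite -surjective_pairing.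
Qed.

Lemma lift_dart_shift x y u : (lift_dart x).1 = shift (lift_dart y).1 u ->
  (lift_dart x).1 = (lift_dart y).1.
Proof.
case: x y => [[jx ix] dx'] [[jy iy] dy']; rewrite /lift_dart /shift /= => -[].
move=> e1 e2; rewrite e2; congr pair.
have u0 : u = 0 by have := ltn_ord jx; have := ltn_ord jy; nia.
by rewrite e1 u0 mul0r addr0.
Qed.

Lemma step_inj : injective step.
Proof.
move=> x y e.
have vxy : valid x = valid y by rewrite -valid_step e valid_step.
have [vx|vx] := boolP (valid x); last first.
  by move: e; rewrite /step -vxy (negbTE vx).
have vy : valid y by rewrite -vxy.
have [u uE] := lift_step vx; have [w wE] := lift_step vy.
have h : next_dart (shift (lift_dart x).1 (u - w), (lift_dart x).2) = next_dart (lift_dart y).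
  rewrite next_shift -surjective_pairing; move: uE; rewrite e wE => -[e1 e2 e3].
  rewrite [RHS]surjective_pairing; congr pair => //.
  rewrite [RHS]surjective_pairing /shift; congr pair => //.
  by rewrite /= mulrBl addrA -e1 addrK.
move: h; rewrite [in RHS](surjective_pairing (lift_dart y)) => h.
have {h} [h1 h2 h3] := next_dart_inj (etrans (boundary_shift _ _ _) vx) vy h.
have h : lift_dart x = lift_dart y.
  rewrite [LHS]surjective_pairing [RHS]surjective_pairing; congr pair; last exact: h3.
  apply/esym/(@lift_dart_shift _ _ (u - w)).
  rewrite [LHS]surjective_pairing; congr pair; [exact: esym h1|exact: (congr1 Posz (esym h2))].
case: x y h {e vxy vx vy uE wE h1 h2 h3} => [[jx ix] dx'] [[jy iy] dy'].
by move=> [/ord_inj -> /ord_inj -> ->].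
Qed.

(** With [A] on the left, the eastward edges in column [j] have [A] above them and the westward ones
    have it below. *)
Definition east_count (j : int) : int :=
  \sum_(i < m.+1) (A j i%:Z && ~~ A j (i%:Z - 1))%:Z.
Definition west_count (j : int) : int :=
  \sum_(i < m.+1) (A j (i%:Z - 1) && ~~ A j i%:Z)%:Z.

Lemma succ_pred (k : nat) : k.+1%:Z - 1 = k%:Z.
Proof. by lia. Qed.

Lemma east_west j : east_count j - west_count j = -1.
Proof.
pose f (i : nat) : int := (A j (i%:Z - 1))%:Z.
rewrite /east_count /west_count -sumrB.
transitivity (\sum_(0 <= i < m.+1) (f i.+1 - f i)).
  rewrite big_mkord; apply: eq_bigr => i _; rewrite /f succ_pred.
  by case: (A j i%:Z); case: (A j _).
by rewrite telescope_sumr// /f succ_pred (negbTE (A_top _ _)) ?A_bot.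
Qed.

(** A dart is recorded at its end vertex, so an eastward dart at abscissa [j] runs along column
    [j - 1]; periodicity absorbs this offset. *)
Lemma east_shift : \sum_(j < m) east_count (j%:Z - 1) = \sum_(j < m) east_count j%:Z.
Proof.
rewrite big_ord_recl [RHS]big_ord_recr addrC; congr (_ + _).
  by apply: eq_bigr => j _; rewrite /= /bump leq0n add1n succ_pred.
have -> : (ord_max : 'I_m)%:Z = 0 - 1 + m%:Z by rewrite /=; lia.
by apply: eq_bigr => i _; rewrite !A_per.
Qed.

Definition weight (x : dart) : int := if valid x then dx x.2 else 0.

(* In each column, the membership to [A] drops once more often than it rises. *)
Lemma sum_weight : \sum_x weight x = - m%:Z.
Proof.
have dirE (F : dir -> int) : \sum_d F d =
    F (true, true) + F (true, false) + (F (false, true) + F (false, false)).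
  rewrite (eq_bigr (fun p => (fun a b => F (a, b)) p.1 p.2)); last by case.
  by rewrite -(pair_bigA _ (fun a b => F (a, b))) /= !big_bool.
rewrite (eq_bigr (fun p => (fun a d => weight (a, d)) p.1 p.2)); last by case.
rewrite -(pair_bigA _ (fun a d => weight (a, d))) /=.
transitivity (\sum_(j < m) (east_count (j%:Z - 1) - west_count j%:Z)).
  rewrite (eq_bigr (fun p => (fun (a : 'I_m) (b : 'I_m.+1) => \sum_d weight (a, b, d)) p.1 p.2));
    last by case.
  rewrite -(pair_bigA _ (fun (a : 'I_m) (b : 'I_m.+1) => \sum_d weight (a, b, d))) /=.
  apply: eq_bigr => j _; rewrite /east_count /west_count -sumrB.
  apply: eq_bigr => i _; rewrite dirE /weight /valid /boundary /cell /=.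
  rewrite /dx /= !if_same !add0r addrC.
  by case: (_ && _); case: (_ && _).
rewrite sumrB east_shift -sumrB.
rewrite (eq_bigr (fun=> -1)) => [|j _]; last exact: east_west.
by rewrite sumr_const card_ord mulNrn natz.
Qed.

(** With [N] the order of the permutation [step], the displacements along all orbits add up to
    [- N m], so some orbit has a nonzero one. *)
Lemma winding_orbit : exists x N, iter N step x = x /\
  \sum_(k < N) weight (iter k.+1 step x) != 0.
Proof.
have [N N0 sN] : exists2 N, (0 < N)%N & forall x, iter N step x = x.
  exists #[perm step_inj]%g; first exact: order_gt0.
  move=> x; have := expg_order (perm step_inj) => /permP/(_ x).
  rewrite permX perm1 => h; rewrite -[RHS]h.
  by apply: eq_iter => y; rewrite permE.
have [x xP] : exists x, \sum_(k < N) weight (iter k.+1 step x) != 0.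
  apply/existsP; rewrite -negb_forall; apply/negP => /forallP h.
  have : \sum_x \sum_(k < N) weight (iter k.+1 step x) = 0.
    by apply: big1 => x _; exact/eqP.
  rewrite exchange_big /= (eq_bigr (fun=> - m%:Z)) => [|k _]; last first.
    rewrite -sum_weight -(@reindex_inj _ _ _ _ (iter k.+1 step) predT weight)//.
    elim: (k.+1) => [|j IHj]; first exact: inj_id.
    by move=> x y /step_inj /IHj.
  rewrite sumr_const card_ord => /eqP; lia.
by exists x, N; rewrite sN.
Qed.

Definition adjacent v1 v2 := exists2 d, v2 = target v1 d & boundary v2 d.

(** The orbit is unrolled in the plane by iterating [next_dart]. Its horizontal displacement is the
    sum of the weights, and a multiple of the period because the orbit closes up. *)
Lemma winding_walk : exists N (v : nat -> int * int) (u : int), [/\ u != 0,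
  forall k, adjacent (v k) (v k.+1) & v N = shift (v 0%N) u].
Proof.
have [x [N [xN wx]]] := winding_orbit.
have vx : valid x.
  apply/negPn/negP => vx; move: wx; rewrite big1 ?eqxx// => k _.
  have h (t : nat) : valid (iter t step x) = valid x.
    by elim: t => //= t; rewrite valid_step.
  by rewrite /weight h (negbTE vx).
have vk k : valid (iter k step x) by elim: k => //= k; rewrite valid_step.
pose c k := iter k next_dart (lift_dart x).
have cb k : boundary (c k).1 (c k).2.
  elim: k => [//|k /next_boundary]; by rewrite -surjective_pairing.
have cP k : exists u, lift_dart (iter k step x) = (shift (c k).1 u, (c k).2).
  elim: k => [|k [u uE]].
    by exists 0; rewrite /shift mul0r addr0.
  have [w wE] := lift_step (vk k); exists (u + w).
  rewrite iterS wE uE next_shift -surjective_pairing /c iterS; congr pair.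
  by rewrite /shift /= mulrDl addrA.
have cx k : (c k).1.1 = (c 0%N).1.1 + \sum_(i < k) weight (iter i.+1 step x).
  elim: k => [|k IHk]; first by rewrite big_ord0 addr0.
  rewrite big_ord_recr /= addrA -IHk /weight -/(iter k.+1 step x) vk.
  have [u [_ _ ->]] := cP k.+1; by [].
have [u] := cP N; rewrite xN => /(congr1 fst) c0.
exists N, (fun k => (c k).1), (- u); split.
- apply/eqP => u0; case/eqP: wx; apply: (addrI (c 0%N).1.1).
  rewrite -cx addr0; have -> : (c 0%N).1 = shift (c N).1 u by [].
  by rewrite -(opprK u) u0 oppr0 /shift /= mul0r addr0.
- by move=> k; exists (c k.+1).2 => //; exact: cb.
- have -> : (c 0%N).1 = shift (c N).1 u by [].
  by rewrite /shift /= mulNr addrK -surjective_pairing.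
Qed.

Definition closed_walk N (v : nat -> int * int) (u : int) := [/\ u != 0,
  forall k, (k < N)%N -> adjacent (v k) (v k.+1) & v N = shift (v 0%N) u].

(* A closed walk of minimal length among those of nonzero winding is simple: at a
   repeated vertex it splits into two shorter closed walks, and their windings
   add up to a nonzero number. *)
Lemma simple_closed_walk : exists N (v : nat -> int * int) (u : int),
  closed_walk N v u /\ forall k l w, (k < N)%N -> (l < N)%N ->
    v l = shift (v k) w -> k = l.
Proof.
pose P N := `[< exists (w : nat -> int * int) u, closed_walk N w u >].
have exP : exists N, P N.
  have [N [v [u [u0 va vN]]]] := winding_walk.
  by exists N; apply/asboolP; exists v, u; split.
case: (ex_minnP exP) => N /asboolP[v [u [u0 va vN]]] Nmin.
exists N, v, u; split=> //.
have key k l w : (k < l)%N -> (l < N)%N -> v l = shift (v k) w -> False.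
  move=> kl lN vl; have [w0|w0] := eqVneq w 0; last first.
    have : P (l - k)%N.
      apply/asboolP; exists (fun t => v (k + t)%N), w; split=> //.
        by move=> t tlk; rewrite addnS; apply: va; lia.
      by rewrite subnKC ?addn0// ltnW.
    by move/Nmin; lia.
  have {}vl : v l = v k.
    by rewrite vl w0 /shift mul0r addr0 -surjective_pairing.
  have : P (N - (l - k))%N.
    apply/asboolP; exists (fun t => if (t <= k)%N then v t else v (t + (l - k))%N), u.
    split=> //=.
      move=> t tN; have [tk|tk|tk] := ltngtP t k.
      + by apply: va; lia.
      + by rewrite addSn; apply: va; lia.
      + rewrite tk -vl; have -> : (k.+1 + (l - k))%N = l.+1 by lia.
        by apply: va.
    rewrite leqNgt; have -> : (k < N - (l - k))%N by lia.
    by rewrite /= subnK//; lia.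
  by move/Nmin; lia.
move=> k l w kN lN vl; have [kl|kl|//] := ltngtP k l; first by case: (key _ _ _ kl lN vl).
case: (key l k (- w) kl kN); rewrite vl /shift /= mulNr addrK.
by rewrite -surjective_pairing.
Qed.

Lemma closed_walk_long N (v : nat -> int * int) u : closed_walk N v u -> (m <= N)%N.
Proof.
move=> [u0 va vN].
have h k : (k <= N)%N -> `|(v k).1 - (v 0%N).1| <= k%:Z.
  elim: k => [_|k IHk kN]; first by rewrite subrr normr0.
  have [d -> _] := va k kN; have := IHk (ltnW kN).
  rewrite /target /dx /=; case: ifP => _; [|case: ifP => _]; lia.
by have := h N (leqnn N); rewrite vN /shift /=; nia.
Qed.

End GridWalk.

(** * The polygonal curve of a closed walk *)

Section PeriodicExtension.
Context {R : realType}.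
Implicit Types (s t : R) (k : int).

Definition frac s : R := s - (Num.floor s)%:~R.

Lemma frac_itv s : 0 <= frac s < 1.
Proof.
have /andP[h1 h2] := floor_itv s; rewrite /frac; apply/andP; split; first by lra.
by move: h2; rewrite intrD; lra.
Qed.

Lemma frac_add1 s : frac (s + 1) = frac s.
Proof. by rewrite /frac floorDrz// floor1 intrD; ring. Qed.

Definition extend (g : R -> R) (w s : R) : R :=
  g (frac s) + (Num.floor s)%:~R * w.

Lemma extend_add1 g w s : extend g w (s + 1) = extend g w s + w.
Proof. by rewrite /extend frac_add1 floorDrz// floor1 intrD mulrDl mul1r addrA. Qed.

Lemma extend_continuous (g : R -> R) (w : R) :
  continuous g -> g 1 = g 0 + w -> continuous (extend g w).
Proof.
move=> cg g1 s0; set k := Num.floor s0; pose K : R := k%:~R.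
(* A single formula on both sides of [K]: to the left the second value of [g] is [g 0], to the right
   the first one is [g 1 = g 0 + w]. *)
pose e s := g (clamp01 (s - K + 1)) + g (clamp01 (s - K)) - g 0 + (K - 1) * w.
have cc := @clamp01_continuous R.
have ce : continuous e by rewrite /e; cont.
have eE s : K - 1 < s < K + 1 -> extend g w s = e s.
  move=> /andP[s1 s2]; rewrite /extend /frac /e.
  have [sk|sk] := ltP s K.
    have -> : Num.floor s = k - 1.
      by apply: floor_def; rewrite subrK -/K intrB -/K; lra.
    rewrite intrB -/K (@clamp01_id _ (s - K + 1)); last by lra.
    by rewrite (@clamp01_le0 _ (s - K)) ?addrK ?opprB ?addrA; [congr (g _ + _); ring|lra].
  have -> : Num.floor s = k by apply: floor_def; rewrite intrD -/K; lra.
  rewrite -/K (@clamp01_ge1 _ (s - K + 1)); last by lra.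
  rewrite (@clamp01_id _ (s - K)); last by lra.
  by rewrite g1; ring.
have /andP[h1 h2] := floor_itv s0; rewrite intrD -/k -/K in h1 h2.
have near0 : \forall s \near s0, K - 1 < s < K + 1.
  by near=> s; apply/andP; split; near: s; [apply: lt_nbhsr|apply: lt_nbhsl]; lra.
rewrite /continuous_at eE; last by lra.
apply: cvg_trans (ce s0); apply: near_eq_cvg; near=> s.
by apply/esym/eE; near: s.
Unshelve. all: by end_near. Qed.

Definition polyline (c : nat -> R) N t : R :=
  c 0%N + \sum_(k < N) clamp01 (t - k%:R) * (c k.+1 - c k).

Lemma polyline_continuous c N : continuous (polyline c N).
Proof.
have ck (k : nat) : continuous (fun t => clamp01 (t - k%:R) * (c k.+1 - c k)).
  by have cc := @clamp01_continuous R; cont.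
have cs := @fun_continuous_sum R R N _ ck.
by rewrite /polyline; cont.
Qed.

Lemma polyline_end c N t : N%:R <= t -> polyline c N t = c N.
Proof.
elim: N => [|N IHN] Nt; rewrite /polyline; first by rewrite big_ord0 addr0.
rewrite -natr1 in Nt.
rewrite big_ord_recr /= addrA -/(polyline c N t) IHN; last by lra.
by rewrite clamp01_ge1 ?mul1r ?subrKC//; lra.
Qed.

Lemma polyline_edge c N (k : nat) t : (k < N)%N -> k%:R <= t <= k.+1%:R ->
  polyline c N t = c k + (t - k%:R) * (c k.+1 - c k).
Proof.
elim: N => // N IHN; rewrite ltnS leq_eqVlt => kN /andP[tk tk1].
rewrite /polyline big_ord_recr /= addrA -/(polyline c N t).
case/orP: kN => [/eqP <-|kN].
  rewrite polyline_end// clamp01_id//; move: tk1; rewrite -natr1; lra.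
rewrite IHN ?tk// clamp01_le0 ?mul0r ?addr0// subr_le0.
by apply: le_trans tk1 _; rewrite ler_nat.
Qed.

Lemma int_small1 k : -1 < k%:~R :> R -> k%:~R < 1 :> R -> k = 0.
Proof.
by rewrite (_ : -1 = (-1)%:~R)// (_ : 1 = 1%:~R)// !ltr_int; lia.
Qed.

Lemma int_small2 k : -2 < k%:~R :> R -> k%:~R < 2 :> R -> [\/ k = -1, k = 0 | k = 1].
Proof.
move=> h1 h2; have {}h1 : -2 < k by rewrite -(ltr_int R) intrN.
have {}h2 : k < 2 by rewrite -(ltr_int R).
have : [|| k == -1, k == 0 | k == 1] by lia.
by case/or3P => /eqP; [constructor 1|constructor 2|constructor 3].
Qed.

End PeriodicExtension.

(** * Meeting points of grid edges *)

Section GridEdges.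
Context {R : realType}.
Variable n : nat.
Local Notation m := (n.+1)%N.
Variable A : int -> int -> bool.

Definition in_cell (j i : int) (p : R * R) :=
  (j%:~R <= p.1 <= j%:~R + 1) /\ (i%:~R <= p.2 <= i%:~R + 1).

Lemma boundary_cells (V : int * int) (d : dir) (t : R) : boundary A V d ->
  0 <= t <= 1 ->
  let p := (V.1%:~R - t * (dx d)%:~R, V.2%:~R - t * (dy d)%:~R) in
  (exists j i, A j i /\ in_cell j i p) /\ (exists j i, ~~ A j i /\ in_cell j i p).
Proof.
rewrite /boundary => /andP[b1 b2] /andP[t0 t1] /=.
split; [move: b1 => {b2}|move: b2 => {b1}]; rewrite /cell;
  case: d => [[] []] /= h; do 2 eexists; (split; first exact: h);
  rewrite /in_cell /dx /dy /= ?intrB ?intrN; lra.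
Qed.

(** Edges with a common point start at lattice points that differ by less than 2 in each coordinate,
    which leaves finitely many cases. *)
Lemma edges_meet_aux (k1 k2 : int) (d e : dir) (a b : R) :
  0 <= a < 1 -> 0 <= b < 1 ->
  k1%:~R = b * (dx e)%:~R - a * (dx d)%:~R ->
  k2%:~R = b * (dy e)%:~R - a * (dy d)%:~R ->
  [/\ k1 = 0, k2 = 0 & a = b] \/
  [/\ k1 = - dx d, k2 = - dy d, dx e = - dx d & dy e = - dy d].
Proof.
move=> /andP[a0 a1] /andP[b0 b1].
have := @int_small2 R k1; have := @int_small2 R k2.
rewrite /dx /dy; case: d e => [[] []] [[] []] /=;
  rewrite ?intrN ?mulrN ?mulr1 ?mulr0 ?subr0 ?sub0r ?opprK ?oppr0;
  move=> s2 s1 e1 e2;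
  have [k2E|k2E|k2E] := s2 ltac:(clear s1 s2; lra) ltac:(clear s1 s2; lra);
  rewrite {}k2E ?intrN /= {s2} in e2 *; try (clear s1 e1; exfalso; lra);
  have [k1E|k1E|k1E] := s1 ltac:(clear s1; lra) ltac:(clear s1; lra);
  rewrite {}k1E ?intrN /= {s1} in e1 *;
  first [exfalso; lra | by left; split=> //; lra | by right].
Qed.

Lemma edges_meet (V W : int * int) (d e : dir) (a b : R) (z : int) :
  0 <= a < 1 -> 0 <= b < 1 ->
  V.1%:~R + a * (dx d)%:~R = W.1%:~R + b * (dx e)%:~R + z%:~R * m%:R ->
  V.2%:~R + a * (dy d)%:~R = W.2%:~R + b * (dy e)%:~R ->
  (V = shift n W z /\ a = b) \/
  (target V d = shift n W z /\ V = shift n (target W e) z).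
Proof.
case: V W => [x1 y1] [x2 y2] /= /andP[a0 a1] /andP[b0 b1] hx hy.
have zm : z%:~R * m%:R = (z * m%:Z)%:~R :> R by rewrite intrM.
rewrite zm in hx.
have [] := @edges_meet_aux (x1 - x2 - z * m%:Z) (y1 - y2) d e a b.
- by rewrite a0.
- by rewrite b0.
- by rewrite !intrB; lra.
- by rewrite !intrB; lra.
- by move=> [k1 k2 ab]; left; split=> //; rewrite /shift /=; congr pair; lia.
- by move=> [k1 k2 e1 e2]; right; rewrite /shift /target /=; split; congr pair; lia.
Qed.

End GridEdges.

(** * The simple closed curve along a simple closed walk *)

Section ClosedWalkCurve.
Context {R : realType}.
Variable n : nat.
Local Notation m := (n.+1)%N.
Variable A : int -> int -> bool.
Hypothesis A_bot : forall j i : int, i <= 0 -> A j i.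
Hypothesis A_top : forall j i : int, m%:Z <= i -> ~~ A j i.
Hypothesis A_per : forall j i : int, A (j + m%:Z) i = A j i.
Hypothesis n2 : (1 < n)%N.

Lemma shift_shift v z w : shift n (shift n v z) w = shift n v (z + w).
Proof. by rewrite /shift /= mulrDl addrA. Qed.

Lemma shiftK v z : shift n (shift n v z) (- z) = v.
Proof. by rewrite shift_shift subrr /shift mul0r addr0 -surjective_pairing. Qed.

(** On a simple walk, an edge traversed both ways would make [a] and [b] cyclic successors of each
    other, which needs [N <= 2]. *)
Lemma no_backtrack N (v : nat -> int * int) u a b z : (2 < N)%N ->
  v N = shift n (v 0%N) u ->
  (forall k l w, (k < N)%N -> (l < N)%N -> v l = shift n (v k) w -> k = l) ->
  (a < N)%N -> (b < N)%N ->
  v a.+1 = shift n (v b) z -> v a = shift n (v b.+1) z -> False.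
Proof.
move=> N2 vN simple aN bN h1 h2.
have N0 : (0 < N)%N by lia.
have succ k l w : (k < N)%N -> (l < N)%N -> v k.+1 = shift n (v l) w ->
    (k.+1 = N /\ l = 0%N) \/ k.+1 = l.
  move=> kN lN; have [kE|kE] := eqVneq k.+1 N.
    rewrite kE vN => /(congr1 (fun x => shift n x (- u))); rewrite shiftK shift_shift.
    by move/(simple _ _ _ lN N0); left.
  move=> h; right; apply/esym/(simple _ _ _ lN _ h); lia.
have h3 : v b.+1 = shift n (v a) (- z) by rewrite h2 shiftK.
by have := succ _ _ _ aN bN h1; have := succ _ _ _ bN aN h3; lia.
Qed.

Lemma grid_curve : exists (g : R -> R * R) (u : int),
  [/\ u != 0, continuous g,
      forall s, g (s + 1) = ((g s).1 + u%:~R * m%:R, (g s).2),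
      forall s t (z : int), g s = ((g t).1 + z%:~R * m%:R, (g t).2) ->
        s - t \is a Num.int &
      forall s, (exists j i, A j i /\ in_cell j i (g s)) /\
                (exists j i, ~~ A j i /\ in_cell j i (g s))].
Proof.
have [N [v [u [wv simple]]]] := simple_closed_walk A_bot A_top A_per.
have N2 : (2 < N)%N by have := closed_walk_long wv; lia.
have [u0 va vN] := wv.
pose c1 k : R := (v k).1%:~R; pose c2 k : R := (v k).2%:~R.
pose f1 t := polyline c1 N (N%:R * t); pose f2 t := polyline c2 N (N%:R * t).
have cf1 : continuous f1 by have := @polyline_continuous R c1 N => cp; rewrite /f1; cont.
have cf2 : continuous f2 by have := @polyline_continuous R c2 N => cp; rewrite /f2; cont.
have N0 : (0 : R) < N%:R by rewrite ltr0n; lia.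
have f0 (c : nat -> R) : polyline c N (N%:R * 0) = c 0%N.
  rewrite mulr0 (@polyline_edge R c N 0) ?subrr ?mul0r ?addr0//; first by lia.
  by rewrite lexx ler01.
have fN (c : nat -> R) : polyline c N (N%:R * 1) = c N by rewrite mulr1 polyline_end.
have edge s : exists a d (t : R), [/\ (a < N)%N, v a.+1 = target (v a) d,
    boundary A (v a.+1) d, 0 <= t < 1 & [/\ N%:R * frac s = a%:R + t,
    f1 (frac s) = (v a).1%:~R + t * (dx d)%:~R &
    f2 (frac s) = (v a).2%:~R + t * (dy d)%:~R]].
  have /andP[s0 s1] := frac_itv s.
  have Ns0 : 0 <= N%:R * frac s by rewrite mulr_ge0// ltW.
  have /andP[a0 a1] := truncn_itv Ns0.
  set a := Num.truncn _ in a0 a1.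
  have aN : (a < N)%N.
    rewrite -(ltr_nat R); apply: le_lt_trans a0 _.
    by rewrite -[ltRHS]mulr1 ltr_pM2l.
  have [d vd bd] := va a aN.
  have h : a%:R <= N%:R * frac s <= a.+1%:R by rewrite a0 ltW.
  exists a, d, (N%:R * frac s - a%:R); split=> //.
    by rewrite subr_ge0 a0 /= ltrBlDl natr1.
  rewrite /f1 /f2 !(polyline_edge _ aN h) /c1 /c2 vd /target /= !intrD.
  by split; rewrite ?[_ + _ - _]addrAC ?subrr ?add0r //; ring.
exists (fun s => (extend f1 (u%:~R * m%:R) s, extend f2 0 s)), u; split=> //.
- apply: fun_continuous_pair; apply: extend_continuous => //.
    by rewrite /f1 f0 fN /c1 vN /shift /= intrD intrM.
  by rewrite /f2 f0 fN /c2 vN /shift /= addr0.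
- by move=> s /=; rewrite !extend_add1 addr0.
- move=> s t z [] /=; rewrite /extend !mulr0 !addr0.
  have [a [d [x [aN ad _ x01 [xE -> ->]]]]] := edge s.
  have [b [e [y [bN be _ y01 [yE -> ->]]]]] := edge t.
  (* Both edges are taken in the first lap; [w] adds to [z] the periods due to the integer parts of
     [s] and [t]. *)
  pose w := z + u * (Num.floor t - Num.floor s).
  have wE : w%:~R = z%:~R + u%:~R * ((Num.floor t)%:~R - (Num.floor s)%:~R) :> R.
    by rewrite /w intrD intrM intrB.
  move=> e1 e2.
  have [] := @edges_meet R n (v a) (v b) d e x y w x01 y01 _ e2.
  + rewrite wE; move: e1; rewrite !mulrDl => e1; lra.
  + move=> [vab xy]; have ab := simple _ _ _ bN aN vab.
    have fst : frac s = frac t.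
      by apply: (mulfI (lt0r_neq0 N0)); rewrite xE yE ab xy.
    rewrite -[s](subrK (Num.floor s)%:~R) -[t](subrK (Num.floor t)%:~R).
    rewrite -/(frac s) -/(frac t) fst opprD addrACA subrr add0r -intrB.
    exact: intr_int.
  + rewrite -ad -be => -[h1 h2].
    by case: (no_backtrack N2 vN simple aN bN h1 h2).
- move=> s.
  have [a [d [x [aN ad bd /andP[x0 x1] [_ E1 E2]]]]] := edge s.
  pose k := u * Num.floor s.
  have gE : (extend f1 (u%:~R * m%:R) s, extend f2 0 s) =
      ((shift n (v a.+1) k).1%:~R - (1 - x) * (dx d)%:~R,
       (shift n (v a.+1) k).2%:~R - (1 - x) * (dy d)%:~R).
    rewrite /extend E1 E2 mulr0 addr0 ad /shift /target /k /=.
    by rewrite !intrD !intrM; congr pair; ring.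
  rewrite gE; apply: boundary_cells; last by apply/andP; split; lra.
  by rewrite boundary_shift.
Qed.

End ClosedWalkCurve.

(** * Twist maps of the plane *)

Lemma unbounded_lift_surj (R : realType) (g : R -> R) : continuous g ->
  (forall x, g (x + 1) = g x + 1) -> forall y, exists x, g x = y.
Proof.
move=> cg g1 y.
have gp (k : nat) : g k%:R = g 0 + k%:R.
  by elim: k => [|k IHk]; rewrite ?addr0// -natr1 g1 IHk addrA.
have gn (k : nat) : g (- k%:R) = g 0 - k%:R.
  elim: k => [|k IHk]; first by rewrite oppr0 addr0.
  apply: (addIr 1); rewrite -g1 -natr1.
  by rewrite opprD subrK IHk; ring.
pose k := (Num.truncn `|y - g 0|).+1.
have : `|y - g 0| <= k%:R by rewrite ltW// truncnS_gt.
rewrite ler_norml => /andP[h1 h2].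
have k0 : 0 <= k%:R :> R by rewrite ler0n.
have [|c _ <-] := @ivt R g (- k%:R) k%:R y cg ltac:(lra); last by exists c.
rewrite gp gn ge_min le_max; apply/andP; split; apply/orP; [left|right]; lra.
Qed.

(* The lift of a twist homeomorphism, extended to the plane so that points below
   the strip creep up to its lower edge and points above it escape upwards. *)
Record twist_map (R : realType) (F : R * R -> R * R) (g0 g1 : R -> R) : Prop :=
  TwistMap {
  twist_continuous : continuous F;
  twist_inj : injective F;
  twist_periodic : forall x y, F (x + 1, y) = ((F (x, y)).1 + 1, (F (x, y)).2);
  twist_nofix : forall z, F z != z;
  twist_bot : forall x y, y <= 0 -> F (x, y) = (g0 x, y / 2);
  twist_top : forall x y, 1 <= y -> F (x, y) = (g1 x, y *+ 2 - 1);
  twist_bot_lt : forall x, g0 x < x;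
  twist_top_gt : forall x, x < g1 x;
  twist_strip : forall x y, 0 <= y <= 1 -> 0 <= (F (x, y)).2 <= 1 }.

Section TwistMap.
Context {R : realType}.
Variables (F : R * R -> R * R) (g0 g1 : R -> R).
Hypothesis tF : twist_map F g0 g1.

Lemma twist_bot_surj y : exists x, g0 x = y.
Proof.
have cF := twist_continuous tF.
have g0E x : g0 x = (F (x, 0)).1 by rewrite (twist_bot tF).
apply: unbounded_lift_surj => [|x]; last by rewrite !g0E (twist_periodic tF).
by rewrite (_ : g0 = fun x => (F (x, 0)).1); [cont|exact/funext].
Qed.

Lemma twist_top_surj y : exists x, g1 x = y.
Proof.
have cF := twist_continuous tF.
have g1E x : g1 x = (F (x, 1)).1 by rewrite (twist_top tF).
apply: unbounded_lift_surj => [|x]; last by rewrite !g1E (twist_periodic tF).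
by rewrite (_ : g1 = fun x => (F (x, 1)).1); [cont|exact/funext].
Qed.

Lemma twist_periodicZ (k : int) x y :
  F (x + k%:~R, y) = ((F (x, y)).1 + k%:~R, (F (x, y)).2).
Proof.
have nat_case (l : nat) x' :
    F (x' + l%:R, y) = ((F (x', y)).1 + l%:R, (F (x', y)).2).
  elim: l => [|l IHl]; first by rewrite !addr0; case: (F _).
  by rewrite -natr1 !addrA (twist_periodic tF) IHl.
case: k => l; first exact: nat_case.
rewrite NegzE intrN /=; have := nat_case l.+1 (x - l.+1%:R).
by rewrite subrK => ->; rewrite addrK; case: (F _).
Qed.

(** By periodicity a compact rectangle suffices. The band contains all points that [F] sends to
    heights between -1 and 2, the range in which [F] will be perturbed. *)
Lemma twist_displacement : exists2 e : R, 0 < e & forall z, -2 <= z.2 <= 3 ->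
  e <= Num.max `|(disp F z).1| `|(disp F z).2|.
Proof.
have cF := twist_continuous tF.
pose K : set (R * R) := `[0, 1]%classic `*` `[-2, 3]%classic.
have cK : compact K by apply: compact_setX; exact: segment_compact.
pose f z := Num.max `|(disp F z).1| `|(disp F z).2|.
have cf : continuous f.
  by have cd := disp_continuous cF; rewrite /f; cont.
have [|p _ pmin] := compact_EVT_min _ cK (continuous_subspaceT cf).
  by exists (0, 0); split; rewrite /= in_itv /=; apply/andP; split; lra.
have f0 : 0 < f p.
  have := disp_neq0 (twist_nofix tF p); rewrite /f; case: (disp F p) => a b /=.
  rewrite lt_max !normr_gt0 xpair_eqE negb_and; by [].
exists (f p) => // -[x y] /= y23.
have /andP[x0 x1] := frac_itv x.
have : f p <= f (frac x, y).
  apply: pmin; rewrite inE; split; rewrite /= in_itv /= ?x0 ?y23//.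
  exact: ltW.
rewrite /f /disp /=; have -> : F (x, y) =
    ((F (frac x, y)).1 + (Num.floor x)%:~R, (F (frac x, y)).2).
  by rewrite -twist_periodicZ /frac subrK.
move: (F (frac x, y)) => q; rewrite /frac /= => h.
by have -> : q.1 + (Num.floor x)%:~R - x = q.1 - (x - (Num.floor x)%:~R) by ring.
Qed.

Lemma twist_below z : z.2 <= 1 -> (F z).2 <= 1.
Proof.
case: z => x y /= y1; have [y0|/ltW y0] := leP 0 y.
  have y01 : 0 <= y <= 1 by rewrite y0.
  by have /andP[] := twist_strip tF x y01.
by rewrite (twist_bot tF)//=; lra.
Qed.

End TwistMap.

(** * Chains of bricks *)

Section Bricks.
Context {R : realType}.

(* A lift to the strip of a simple closed curve of degree [u] in the annulus that
   is disjoint from its image. *)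
Definition free_curve (F : R * R -> R * R) (g : R -> R * R) (u : int) : Prop :=
  [/\ u != 0, continuous g,
      forall s, g (s + 1) = ((g s).1 + u%:~R, (g s).2),
      forall s t (z : int), g s = ((g t).1 + z%:~R, (g t).2) ->
        s - t \is a Num.int &
      (forall s, 0 <= (g s).2 <= 1) /\
      forall s t (z : int), F (g s) <> ((g t).1 + z%:~R, (g t).2)].

Variable n : nat.
Local Notation m := (n.+1)%N.
Variables (F : R * R -> R * R) (g0 g1 : R -> R).
Hypothesis tF : twist_map F g0 g1.

(* The bottom and the top rows of bricks straddle the two edges of the strip. *)
Definition brick (b : int * int) (p : R * R) : Prop :=
  in_cell b.1 b.2 (p.1 * m%:R, p.2 * m%:R + 1 / 2).

Definition brick_map (b c : int * int) : Prop := exists2 p, brick b p & brick c (F p).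

Definition brick_chain k (c : nat -> int * int) : Prop :=
  (c 0%N).2 <= 0 /\ forall i, (i < k)%N -> brick_map (c i) (c i.+1).

Lemma brick_shift b z p : brick b p -> brick (shift n b z) (p.1 + z%:~R, p.2).
Proof.
move=> [h1 h2]; split => //=; rewrite intrD intrM mulrDl.
have -> : (m%:Z)%:~R = m%:R :> R by [].
move: h1 => /=; lra.
Qed.

Lemma brick_map_shift b c z : brick_map b c -> brick_map (shift n b z) (shift n c z).
Proof.
move=> [p bp cp]; exists (p.1 + z%:~R, p.2); first exact: brick_shift.
by rewrite (twist_periodicZ tF) -surjective_pairing; exact: brick_shift.
Qed.

(** Each point of the boundary curve lies in a brick of the reached set [A] and in one outside. If
    [F] sent a point of the curve to a translate of the curve, a chain would extend to a brick
    outside [A]. *)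
Lemma free_curve_or_chain : (1 < n)%N ->
  (exists g u, free_curve F g u) \/
  (exists k c, brick_chain k c /\ m%:Z <= (c k).2).
Proof.
move=> n1.
pose A (j i : int) := `[< exists k c, brick_chain k c /\ c k = (j, i) >].
have [|/forallNP nochain] := pselect (exists k c, brick_chain k c /\ m%:Z <= (c k).2).
  by right.
left.
have A_bot j i : i <= 0 -> A j i.
  by move=> i0; apply/asboolP; exists 0%N, (fun=> (j, i)).
have A_top j i : m%:Z <= i -> ~~ A j i.
  move=> im; apply/asboolP => -[k [c [ch ck]]].
  by case: (nochain k); exists c; rewrite ck.
have A_shift j i z : A j i -> A (j + z * m%:Z) i.
  move=> /asboolP[k [c [[c0 ch] ck]]]; apply/asboolP.
  exists k, (fun l => shift n (c l) z); split; last by rewrite ck.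
  by split=> // l lk; apply: brick_map_shift; exact: ch.
have A_per j i : A (j + m%:Z) i = A j i.
  apply/idP/idP => [/(A_shift _ _ (-1))|/(A_shift _ _ 1)].
    by rewrite mulN1r addrK.
  by rewrite mul1r.
have [g [u [u0 cg gper ginj gcell]]] := @grid_curve R n A A_bot A_top A_per n1.
have m0 : (0 : R) < m%:R by rewrite ltr0n.
have m1 : m%:R != 0 :> R by rewrite gt_eqF.
(* Undoes the scaling and the vertical offset that [brick] applies to points. *)
pose d s := ((g s).1 / m%:R, ((g s).2 - 1 / 2) / m%:R).
have dE s : ((d s).1 * m%:R, (d s).2 * m%:R + 1 / 2) = g s.
  by rewrite /d /= !divfK// subrK -surjective_pairing.
exists d, u; split=> //.
- by rewrite /d; cont.
- move=> s; rewrite /d gper /=; congr pair.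
  by rewrite mulrDl mulfK.
- move=> s t z [] /(congr1 (fun x => x * m%:R)) + /(congr1 (fun x => x * m%:R)).
  rewrite mulrDl !divfK// => e1 /addIr e2; apply: (ginj s t z).
  by rewrite [LHS]surjective_pairing e1 e2.
split=> [s|s t z e].
  have [[j [i [Aij [_ /andP[_ h1]]]]] [j' [i' [Aij' [_ /andP[h2 _]]]]]] := gcell s.
  have im : i + 1 <= m%:Z.
    by rewrite leNgt; apply/negP => im; move: Aij; apply/negP/A_top; lia.
  have i1 : 1 <= i'.
    by rewrite leNgt; apply/negP => i0; move: Aij'; rewrite A_bot//; lia.
  have {}im : i%:~R + 1 <= m%:R :> R.
    by rewrite -[m%:R]/((m%:Z)%:~R) -[1]/(1%:~R) -intrD ler_int.
  have {}i1 : 1 <= i'%:~R :> R by rewrite -[1]/(1%:~R) ler_int.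
  rewrite /d /=; apply/andP; split; last by rewrite ler_pdivrMr// mul1r; lra.
  by apply: divr_ge0; [lra|exact: ltW].
have [[j [i [Aij ds]]] _] := gcell s.
have [_ [j' [i' [Aij' dt]]]] := gcell t.
case/negP: Aij'; suff : A (j' + z * m%:Z) i'.
  by move/(A_shift _ _ (- z)); rewrite mulNr addrK.
move: Aij => /asboolP[k [c [[c0 ch] ck]]]; apply/asboolP.
exists k.+1, (fun l => if (l <= k)%N then c l else (j' + z * m%:Z, i')).
rewrite ltnn; split=> //; split=> //= l; rewrite ltnS => lk'.
have /orP[/eqP ->|lk] : (l == k) || (l < k)%N by rewrite -leq_eqVlt.
  rewrite leqnn ltnn ck; exists (d s); first by rewrite /brick dE.
  by rewrite e; apply: (@brick_shift (j', i')); rewrite /brick dE.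
by rewrite lk' lk; exact: ch.
Qed.

End Bricks.

(** * Shortest chains across the strip *)

Section MinimalChain.
Context {R : realType}.
Variable n : nat.
Local Notation m := (n.+1)%N.
Variables (F : R * R -> R * R) (g0 g1 : R -> R).
Hypothesis tF : twist_map F g0 g1.

(** In a chain of minimal length only the first brick is in a row up to 0 and only the last one in a
    row from [m] on. There are no shortcuts from [c i] to [c j.+1] with [i < j], as a repeated brick
    or point would give. *)
Lemma minimal_chain :
  (exists k c, brick_chain n F k c /\ m%:Z <= (c k).2) ->
  exists N (c : nat -> int * int) (z : nat -> R * R),
  [/\ (0 < N)%N, (c 0%N).2 = 0, (c N).2 = m%:Z,
      forall i, (i < N)%N -> [/\ brick n (c i) (z i), brick n (c i.+1) (F (z i)),
        0 < (F (z i)).2 * m%:R - 1 / 4 & (F (z i)).2 <= 1] &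
      [/\ forall i, (i <= N)%N -> 0 <= (c i).2 <= m%:Z,
          forall i j, (i <= N)%N -> (j <= N)%N -> c i = c j -> i = j &
          forall i j, (i < N)%N -> (j < N)%N -> z i = z j -> i = j]].
Proof.
move=> exc.
pose P k := `[< exists c, brick_chain n F k c /\ m%:Z <= (c k).2 >].
have exP : exists k, P k by have [k [c h]] := exc; exists k; apply/asboolP; exists c.
case: (ex_minnP exP) => N /asboolP[c [[c0 cF] cN]] Nmin.
have N0 : (0 < N)%N by rewrite lt0n; apply/eqP => N0; move: cN; rewrite N0; lia.
have drop i : (0 < i)%N -> (i <= N)%N -> 0 < (c i).2.
  move=> i0 iN; rewrite ltNge; apply/negP => ci.
  suff /Nmin : P (N - i)%N by lia.
  apply/asboolP; exists (fun k => c (k + i)%N); rewrite subnK//.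
  by split=> //; split=> // k kN; rewrite addSn; apply: cF; lia.
have below i : (i < N)%N -> (c i).2 < m%:Z.
  move=> iN; rewrite ltNge; apply/negP => ci.
  suff /Nmin : P i by lia.
  by apply/asboolP; exists c; split=> //; split=> // k ki; apply: cF; lia.
have shortcut i j : (i < j)%N -> (j < N)%N -> ~ brick_map n F (c i) (c j.+1).
  move=> ij jN cij; suff /Nmin : P (N - (j - i))%N by lia.
  apply/asboolP; exists (fun k => if (k <= i)%N then c k else c (k + (j - i))%N).
  rewrite leqNgt; have -> : (i < N - (j - i))%N by lia.
  rewrite /= subnK//; last by lia.
  split=> //; split=> //= k kN; have [ki|ki|ki] := ltngtP k i.
  + by apply: cF; lia.
  + by rewrite addSn; apply: cF; lia.
  + by rewrite ki (_ : i.+1 + (j - i) = j.+1)%N//; lia.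
have /choice[z zP] (i : nat) : exists z, (i < N)%N ->
    brick n (c i) z /\ brick n (c i.+1) (F z).
  have [iN|iN] := boolP (i < N)%N; last by exists (0, 0).
  by have [p p1 p2] := cF i iN; exists p.
have m0 : (0 : R) < m%:R by rewrite ltr0n.
have row i : (0 < i)%N -> (i <= N)%N -> 1 <= (c i).2%:~R :> R.
  by move=> i0 iN; rewrite -[1]/(1%:~R) ler_int; have := drop i i0 iN; lia.
have low i : (i < N)%N -> 0 < (F (z i)).2 * m%:R - 1 / 4.
  move=> iN; have [_ [_ /= /andP[h _]]] := zP i iN; have := row i.+1 isT iN; lra.
have cm i : (i < N)%N -> (c i).2%:~R + 1 <= m%:R :> R.
  move=> iN; rewrite -[m%:R]/((m%:Z)%:~R) -[1]/(1%:~R) -intrD ler_int.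
  by have := below i iN; lia.
have zi1 i : (i < N)%N -> (z i).2 <= 1.
  move=> iN; have [[_ /= /andP[_ h]] _] := zP i iN; have := cm i iN => h2.
  by rewrite -(ler_pM2r m0); lra.
have high i : (i < N)%N -> (F (z i)).2 <= 1.
  by move=> iN; apply: (twist_below tF); exact: zi1.
(* A start below row 0 would put [z 0] at height at most 0, where [F] cannot lift it into the next
   brick. *)
have c00 : (c 0%N).2 = 0.
  apply/eqP; rewrite eq_le c0 /= leNgt; apply/negP => c0'.
  have [[_ /= /andP[_ h]] _] := zP 0%N N0; have hl := low 0%N N0.
  have {}c0' : (c 0%N).2%:~R + 1 <= 0 :> R.
    by rewrite -[1]/(1%:~R) -intrD -[0]/(0%:~R) ler_int; lia.
  have z0 : (z 0%N).2 <= 0 by rewrite -(ler_pM2r m0); lra.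
  have := hl; rewrite [z 0%N]surjective_pairing (twist_bot tF)//= => h3.
  have : (z 0%N).2 / 2 * m%:R <= 0.
    by rewrite mulr_le0_ge0// ?ltW//; lra.
  by lra.
have cNm : (c N).2 = m%:Z.
  apply/eqP; rewrite eq_le cN andbT leNgt; apply/negP => cN'.
  have NE : N = N.-1.+1 by rewrite prednK.
  have N1 : (N.-1 < N)%N by rewrite ltn_predL.
  have [_ [_ /= /andP[h _]]] := zP _ N1; rewrite -NE in h.
  have := high _ N1; rewrite -(ler_pM2r m0) mul1r => h2.
  have : m%:R + 1 <= (c N).2%:~R :> R.
    by rewrite -[m%:R]/((m%:Z)%:~R) -[1]/(1%:~R) -intrD ler_int; lia.
  lra.
exists N, c, z; split=> //.
  by move=> i iN; have [h1 h2] := zP i iN; split=> //; [exact: low|exact: high].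
have cinj i j : (i < j)%N -> (j <= N)%N -> c i <> c j.
  move=> ij jN e; have [jE|jE] := eqVneq j N.
    by have := below i; rewrite e jE cNm ltxx => /(_ _)/negP; apply; lia.
  by apply: (shortcut i j ij); [lia|rewrite e; apply: cF; lia].
have zinj i j : (i < j)%N -> (j < N)%N -> z i <> z j.
  move=> ij jN e; apply: (shortcut i j ij jN); exists (z i).
    by have [] := zP i (ltn_trans ij jN).
  by rewrite e; have [] := zP j jN.
split.
- move=> i iN; have [->|i0] := posnP i; first by rewrite c00; lia.
  rewrite ltW ?drop//=; move: iN; rewrite leq_eqVlt => /orP[/eqP ->|/below].
    by rewrite cNm.
  exact: ltW.
- move=> i j iN jN e; have [ij|ij|//] := ltngtP i j.
    by case: (cinj _ _ ij jN).
  by case: (cinj _ _ ij iN).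
- move=> i j iN jN e; have [ij|ij|//] := ltngtP i j.
    by case: (zinj _ _ ij jN).
  by case: (zinj _ _ ij iN).
Qed.

End MinimalChain.

(** * Closing a chain of bricks into an orbit *)

Section Perturbation.
Context {R : realType}.

Lemma common_pos N (P : nat -> R -> Prop) :
  (forall i d e, P i d -> 0 < e <= d -> P i e) ->
  (forall i, (i < N)%N -> exists2 d, 0 < d & P i d) ->
  exists2 d, 0 < d & forall i, (i < N)%N -> P i d.
Proof.
move=> mono; elim: N => [_|N IHN exP]; first by exists 1.
have [|d d0 dP] := IHN; first by move=> i iN; apply: exP; exact: ltnW.
have [e e0 eP] := exP N (ltnSn N).
have md : 0 < Num.min d e <= d by rewrite lt_min d0 e0 ge_min lexx.
have me : 0 < Num.min d e <= e by rewrite lt_min d0 e0 ge_min lexx orbT.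
exists (Num.min d e); first by case/andP: md.
move=> i; rewrite ltnS leq_eqVlt => /orP[/eqP ->|/dP/mono]; last exact.
exact: mono eP me.
Qed.

(** With [X] and [Y] the absolute coordinates of [a], the product is at least
    [X ^ 2 + Y ^ 2 - d (X + Y)], which is positive once the larger of them exceeds [2 d]. *)
Lemma dot_close (a b : R * R) (d e : R) :
  `|b.1 - a.1| <= d -> `|b.2 - a.2| <= d -> 0 <= d -> 2 * d < e ->
  e <= Num.max `|a.1| `|a.2| -> 0 < dot b a.
Proof.
case: a b => [x y] [u v] /=; rewrite /dot /= => h1 h2 d0 de.
have hx : - (d * `|x|) <= (u - x) * x.
  by apply: lerNnormlW; rewrite normrM ler_wpM2r.
have hy : - (d * `|y|) <= (v - y) * y.
  by apply: lerNnormlW; rewrite normrM ler_wpM2r.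
have -> : u * x + v * y = x ^+ 2 + y ^+ 2 + (u - x) * x + (v - y) * y by ring.
rewrite -[x ^+ 2]real_normK ?num_real// -[y ^+ 2]real_normK ?num_real//.
move: hx hy (normr_ge0 x) (normr_ge0 y).
move: ((u - x) * x) ((v - y) * y) `|x| `|y| => p q X Y hp hq X0 Y0.
have key (x' y' : R) : 2 * d < x' -> 0 <= y' ->
    0 < x' ^+ 2 - d * x' + (y' ^+ 2 - d * y').
  move=> hx' hy'; have x0 : 0 < x' by lra.
  have A : 0 < (x' - 2 * d) * x' by apply: mulr_gt0 => //; lra.
  have B : 0 <= (x' - 2 * d) * d by apply: mulr_ge0 => //; lra.
  have C := sqr_ge0 (y' - d / 2); have D := sqr_ge0 d.
  by rewrite !expr2 in C D *; lra.
rewrite le_max => /orP[h|h].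
  by have := key X Y ltac:(lra) Y0; lra.
by have := key Y X ltac:(lra) X0; lra.
Qed.

Definition in_square (p : R * R) (s : R) :=
  in_box (p.1 - s, p.2 - s) (p.1 + s, p.2 + s).

Lemma in_squareP p s q :
  reflect ((p.1 - s < q.1 < p.1 + s) /\ (p.2 - s < q.2 < p.2 + s)) (in_square p s q).
Proof. by rewrite /in_square /in_box /=; exact: andP. Qed.

Lemma in_square_near (F : R -> R * R) (s : R) : continuous F -> 0 < s ->
  exists2 d, 0 < d & forall t, 0 < t <= d -> in_square (F 0) s (F t).
Proof.
move=> cF s0.
pose g t := Num.max `|(F t).1 - (F 0).1| `|(F t).2 - (F 0).2|.
have cg : continuous g by rewrite /g; cont.
have : \forall t \near 0, g t < s.
  have := cg 0; move/cvgr_lt; apply.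
  by rewrite /g !subrr normr0 maxxx.
move=> /nbhs_ballP[e /= e0 eP]; exists (e / 2); first by rewrite divr_gt0.
move=> t /andP[t0 te]; have : g t < s.
  apply: eP; rewrite /ball /= sub0r normrN gtr0_norm//; lra.
rewrite /g gt_max !ltr_norml => /andP[/andP[h1 h2] /andP[h3 h4]].
by apply/in_squareP; split; apply/andP; split; lra.
Qed.

Variable n : nat.
Local Notation m := (n.+1)%N.
Local Notation M := (n.+1%:R : R).
Implicit Types b c : int * int.

Definition lo b : R * R := (b.1%:~R / M, (b.2%:~R - 1 / 2) / M).
Definition hi b : R * R := ((b.1%:~R + 1) / M, (b.2%:~R + 1 / 2) / M).
(** Slides [p] towards the centre of the brick, which brings a boundary point into the interior. *)
Definition toward b (p : R * R) (s : R) : R * R :=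
  (p.1 + s * ((b.1%:~R + 1 / 2) / M - p.1), p.2 + s * (b.2%:~R / M - p.2)).

Let M0 : (0 : R) < M. Proof. by rewrite ltr0n. Qed.

Lemma in_brickE b p : in_box (lo b) (hi b) p =
  (b.1%:~R < p.1 * M < b.1%:~R + 1) && (b.2%:~R - 1 / 2 < p.2 * M < b.2%:~R + 1 / 2).
Proof. by rewrite /in_box /= !ltr_pdivrMr// !ltr_pdivlMr. Qed.

Lemma in_brick_inj b c p : in_box (lo b) (hi b) p -> in_box (lo c) (hi c) p -> b = c.
Proof.
rewrite !in_brickE => /andP[/andP[h1 h2] /andP[h3 h4]] /andP[/andP[h5 h6] /andP[h7 h8]].
have e1 : b.1 - c.1 = 0 by apply: (@int_small1 R); rewrite intrB; lra.
have e2 : b.2 - c.2 = 0 by apply: (@int_small1 R); rewrite intrB; lra.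
rewrite [b]surjective_pairing [c]surjective_pairing; move: e1 e2; clear.
move: b.1 c.1 b.2 c.2 => x y z w.
by move=> *; congr pair; lia.
Qed.

Lemma toward_in b p s : brick n b p -> 0 < s <= 1 -> in_box (lo b) (hi b) (toward b p s).
Proof.
move=> [/= /andP[h1 h2] /andP[h3 h4]] /andP[s0 s1]; rewrite in_brickE /=.
have -> : (p.1 + s * ((b.1%:~R + 1 / 2) / M - p.1)) * M =
    p.1 * M + s * (b.1%:~R + 1 / 2 - p.1 * M).
  by field; rewrite gt_eqF.
have -> : (p.2 + s * (b.2%:~R / M - p.2)) * M =
    p.2 * M + s * (b.2%:~R - p.2 * M).
  by field; rewrite gt_eqF.
move: (p.1 * M) (p.2 * M) h1 h2 h3 h4 => x y h1 h2 h3 h4.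
by apply/andP; split; apply/andP; split; nra.
Qed.

Lemma toward_close b p s : brick n b p -> 0 <= s ->
  `|(toward b p s).1 - p.1| <= s / M /\ `|(toward b p s).2 - p.2| <= s / M.
Proof.
move=> [/= /andP[h1 h2] /andP[h3 h4]] s0.
have E (w x : R) : x + s * (w / M - x) - x = s * ((w - x * M) / M).
  by field; rewrite gt_eqF.
have MV : 0 <= M^-1 by rewrite invr_ge0 ltW.
rewrite /toward /= !E !normrM (ger0_norm s0) (ger0_norm MV).
by split; apply: ler_wpM2l => //; apply: ler_piMl => //; rewrite ler_norml; lra.
Qed.

Lemma in_brick_close b p q : in_box (lo b) (hi b) p -> in_box (lo b) (hi b) q ->
  `|p.1 - q.1| <= M^-1 /\ `|p.2 - q.2| <= M^-1.
Proof.
rewrite !in_brickE => /andP[/andP[h1 h2] /andP[h3 h4]] /andP[/andP[h5 h6] /andP[h7 h8]].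
split; rewrite -[M^-1]mul1r ler_pdivlMr// -[M in _ * M]gtr0_norm//;
  rewrite -normrM mulrBl ler_norml; lra.
Qed.

End Perturbation.

(** * The perturbed map and its orbit across the strip *)

Section PerturbedMap.
Context {R : realType}.
Variable n : nat.
Local Notation m := (n.+1)%N.
Local Notation M := (n.+1%:R : R).
Variables (F : R * R -> R * R) (g0 g1 : R -> R) (eps : R).
Hypothesis tF : twist_map F g0 g1.
Hypothesis n1 : (1 < n)%N.
Hypothesis eps_disp : forall z, -2 <= z.2 <= 3 ->
  eps <= Num.max `|(disp F z).1| `|(disp F z).2|.
Hypothesis M_eps : 4 * M^-1 < eps.

(** Preimages under [F] double the depth, starting from [3 / 4 h], so they all lie below [- h],
    where [G] is [F]. *)
Lemma iter_bottom (G : R * R -> R * R) (w : R * R) (h : R) : 0 < h ->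
  (forall w, w.2 <= - h -> G w = F w) ->
  w.2 <= - (3 / 4 * h) -> exists p k, p.2 <= - 2 /\ iter k G p = w.
Proof.
move=> h0 GF w0.
suff back k : exists p, p.2 = w.2 * 2 ^+ k /\ iter k G p = w.
  have [k kE] : exists k : nat, 2 < k%:R * (3 / 4 * h).
    exists (Num.truncn (2 / (3 / 4 * h))).+1.
    by rewrite -ltr_pdivrMr ?truncnS_gt// mulr_gt0.
  have [p [p2 pw]] := back k; exists p, k; split=> //.
  have : k%:R <= 2 ^+ k :> R by rewrite -natrX ler_nat ltnW// ltn_expl.
  move=> kK; have a0 : 0 <= 3 / 4 * h by rewrite mulr_ge0// ltW.
  have a1 := ler_wpM2l a0 kK.
  have a2 : w.2 * 2 ^+ k <= - (3 / 4 * h) * 2 ^+ k by rewrite ler_wpM2r// exprn_ge0.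
  rewrite p2; move: (2 ^+ k : R) kK a1 a2 => K kK a1 a2; lra.
elim: k => [|k [p [p2 pw]]]; first by exists w; rewrite mulr1.
have [x xE] := twist_bot_surj tF p.1.
have k1 : 1 <= 2 ^+ k :> R by rewrite exprn_ege1// ler1n.
have pneg : p.2 <= - (3 / 4 * h).
  rewrite p2 (le_trans _ w0)// -[leRHS]mulr1 ler_wnM2l//; lra.
exists (x, p.2 * 2); split; first by rewrite /= p2 exprSr mulrA.
rewrite iterSr GF /=; last by lra.
rewrite (twist_bot tF) ?mulfK ?pnatr_eq0//; last by lra.
by rewrite xE -surjective_pairing.
Qed.

Lemma iter_top (G : R * R -> R * R) (w : R * R) (h : R) : 0 < h ->
  (forall w, 1 + h / 4 <= w.2 -> G w = F w) ->
  1 + h / 4 <= w.2 -> exists k, 2 <= (iter k G w).2.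
Proof.
move=> h0 GF w0.
have up k : (iter k G w).2 = 1 + (w.2 - 1) * 2 ^+ k.
  elim: k => [|k IHk]; first by rewrite mulr1 subrKC.
  have k1 : 1 <= 2 ^+ k :> R by rewrite exprn_ege1// ler1n.
  have k2 : 1 + h / 4 <= (iter k G w).2.
    rewrite IHk (le_trans w0)// -lerBlDl ler_peMr//; lra.
  rewrite iterS GF// [iter k G w]surjective_pairing (twist_top tF) /=; last by lra.
  by rewrite IHk exprS; ring.
have [k kE] : exists k : nat, 1 < k%:R * (h / 4).
  exists (Num.truncn (1 / (h / 4))).+1.
  by rewrite -ltr_pdivrMr ?truncnS_gt// mulr_gt0.
exists k.
have : k%:R <= 2 ^+ k :> R by rewrite -natrX ler_nat ltnW// ltn_expl.
move=> kK; have a0 : 0 <= h / 4 by rewrite divr_ge0// ltW.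
have a1 := ler_wpM2l a0 kK.
have a2 : h / 4 * 2 ^+ k <= (w.2 - 1) * 2 ^+ k.
  by rewrite ler_wpM2r// ?exprn_ge0//; lra.
rewrite up; move: (2 ^+ k : R) kK a1 a2 => K kK a1 a2; lra.
Qed.

(* The entry points [F z_i] may lie on the boundary of their bricks: pushes inside
   small disjoint squares first bring them into the interiors, and then pushes
   inside the bricks themselves bring them to the next points of the chain. *)
Lemma two_step_push N (c : nat -> int * int) (u w v b2 : nat -> R * R) q0 (s h : R) :
  M^-1 = h -> 0 < h -> h <= 1 / 3 -> 0 < s -> s <= h / 8 ->
  (forall i, (i <= N)%N -> 0 <= (c i).2 <= m%:Z) ->
  (forall i j, (i <= N)%N -> (j <= N)%N -> c i = c j -> i = j) ->
  (forall i, (i < N)%N -> h / 4 < (u i).2) ->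
  (forall i, (i < N)%N -> (u i).2 <= 1) ->
  (forall i, (i < N)%N -> forall j, (j < N)%N -> i <> j ->
    2 * s <= Num.max `|(u i).1 - (u j).1| `|(u i).2 - (u j).2|) ->
  (forall i, (i < N)%N -> in_square (u i) s (w i)) ->
  (forall i, (i < N)%N -> in_square (u i) s (v i)) ->
  (forall i, (i < N)%N -> in_box (lo n (c i.+1)) (hi n (c i.+1)) (v i)) ->
  in_box (lo n (c 0%N)) (hi n (c 0%N)) q0 -> q0.2 <= 0 ->
  (forall i, (i <= N)%N -> in_box (lo n (c i)) (hi n (c i)) (b2 i)) ->
  exists Q : R * R -> R * R, [/\ continuous Q, injective Q,
    Q q0 = b2 0%N /\ forall i, (i < N)%N -> Q (w i) = b2 i.+1,
    forall p, p.2 <= - (h / 2) \/ 1 + h / 2 <= p.2 -> Q p = p &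
    forall p, Q p = p \/ [/\ -1 <= p.2 <= 2,
      `|(Q p).1 - p.1| <= 2 * h & `|(Q p).2 - p.2| <= 2 * h]].
Proof.
move=> hE h0 h3 sgt0 s_h cr cinj u_low u_high u_sep w_in v_in1 v_in q0_in q0_le b2_in.
have M0 : (0 : R) < M by rewrite ltr0n.
have Mh : M * h = 1 by rewrite -hE mulfV// gt_eqF.
have [||P1 [cP1 injP1 P1v P1out P1in]] := @push_family R
  (fun i => ((u i).1 - s, (u i).2 - s)) (fun i => ((u i).1 + s, (u i).2 + s))
  w v N.
- by move=> i iN; apply/andP; split; [exact: w_in|exact: v_in1].
- move=> i j q iN jN /in_squareP[/andP[h1 h2] /andP[h4 h5]].
  move=> /in_squareP[/andP[h6 h7] /andP[h8 h9]].
  apply/eqP/negPn/negP => /eqP ij; have := u_sep i iN j jN ij.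
  by rewrite leNgt gt_max !ltr_norml => /negP; apply; apply/andP; split;
    apply/andP; split; lra.
(* The point that [P2] moves inside brick [c i]: the start [q0], or the entry point prepared by
   [P1]. *)
pose a2 i := if i is i'.+1 then v i' else q0.
have [||P2 [cP2 injP2 P2a P2out P2in]] :=
  @push_family R (fun i => lo n (c i)) (fun i => hi n (c i)) a2 b2 N.+1.
- move=> i iN; apply/andP; split.
    by case: i iN => [//|i] iN; exact: v_in.
  exact: b2_in.
- by move=> i j p iN jN wi wj; apply: cinj => //; exact: in_brick_inj wi wj.
have brick_range i p : (i <= N)%N -> in_box (lo n (c i)) (hi n (c i)) p ->
    - (h / 2) < p.2 < 1 + h / 2.
  move=> iN; rewrite in_brickE => /andP[_ /andP[h1 h2]].
  have /andP[r0 r1] := cr i iN.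
  have {}r0 : 0 <= (c i).2%:~R :> R by rewrite -[0]/(0%:~R) ler_int.
  have {}r1 : (c i).2%:~R <= M by rewrite -[M]/((m%:Z)%:~R) ler_int.
  by apply/andP; split; nra.
have box_range i p : (i < N)%N -> in_square (u i) s p -> 0 < p.2 < 1 + h / 4.
  move=> iN /in_squareP[_ /andP[h1 h2]]; have := u_low i iN; have := u_high i iN.
  by move=> ? ?; apply/andP; split; lra.
pose Q := P2 \o P1.
have P1id p : p.2 <= 0 \/ 1 + h / 4 <= p.2 -> P1 p = p.
  move=> hw; apply: P1out => i iN; apply/negP => /(box_range _ _ iN)/andP[h1 h2].
  by case: hw; lra.
have Qid p : p.2 <= - (h / 2) \/ 1 + h / 2 <= p.2 -> Q p = p.
  move=> hw; rewrite /Q /= P1id; last by case: hw; [left|right]; lra.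
  apply: P2out => i iN; apply/negP => /(brick_range _ _ iN)/andP[h1 h2].
  by case: hw; lra.
have P2move p : P2 p = p \/ [/\ - (h / 2) < p.2 < 1 + h / 2,
    `|(P2 p).1 - p.1| <= h & `|(P2 p).2 - p.2| <= h].
  have [[i iN wi]|nw] := pselect (exists2 i, (i < N.+1)%N &
      in_box (lo n (c i)) (hi n (c i)) p); last first.
    by left; apply: P2out => i iN; apply/negP => wi; apply: nw; exists i.
  right; have [h1 h2] := in_brick_close (P2in i p iN wi) wi; rewrite hE in h1 h2.
  by split=> //; exact: brick_range wi.
have P1move p : P1 p = p \/ [/\ 0 < p.2 < 1 + h / 4,
    `|(P1 p).1 - p.1| <= h & `|(P1 p).2 - p.2| <= h].
  have [[i iN wi]|nw] := pselect (exists2 i, (i < N)%N &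
      in_square (u i) s p); last first.
    by left; apply: P1out => i iN; apply/negP => wi; apply: nw; exists i.
  right; split; first exact: box_range wi.
    have /in_squareP[/andP[h1 h2] _] := P1in i p iN wi.
    move: wi => /in_squareP[/andP[h4 h5] _].
    by rewrite ler_norml; apply/andP; split; lra.
  have /in_squareP[_ /andP[h1 h2]] := P1in i p iN wi.
  move: wi => /in_squareP[_ /andP[h4 h5]].
  by rewrite ler_norml; apply/andP; split; lra.
have Qmove p : Q p = p \/ [/\ -1 <= p.2 <= 2,
    `|(Q p).1 - p.1| <= 2 * h & `|(Q p).2 - p.2| <= 2 * h].
  rewrite /Q /=; case: (P1move p) => [->|[/andP[h1 h2]]].
    case: (P2move p) => [->|[/andP[h1 h2]]]; first by left.
    rewrite !ler_norml => /andP[h4 h5] /andP[h6 h7]; right.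
    by split; apply/andP; split; lra.
  rewrite !ler_norml => /andP[h4 h5] /andP[h6 h7]; right.
  case: (P2move (P1 p)) => [->|[_]]; first by split; apply/andP; split; lra.
  rewrite !ler_norml => /andP[h8 h9] /andP[h10 h11].
  by split; apply/andP; split; lra.
exists Q; split=> //.
- by move=> p; apply: continuous_comp; [exact: cP1|exact: cP2].
- exact: inj_comp.
- split=> [|i iN]; first by rewrite /Q /= P1id ?(P2a 0%N)//; left.
  by rewrite /Q /= P1v// (P2a i.+1).
Qed.

Lemma orbit_perturbation :
  (exists k c, brick_chain n F k c /\ m%:Z <= (c k).2) ->
  exists G : R * R -> R * R, [/\ continuous G, injective G,
    forall w, w.2 <= -1 -> G w = F w, forall w, 2 <= w.2 -> G w = F w &
    (exists p k, p.2 <= -2 /\ 2 <= (iter k G p).2) /\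
    forall z, 0 < dot (disp G z) (disp F z)].
Proof.
move=> /(minimal_chain tF)[N [c [z [N0 c0 cN zP [cr cinj zinj]]]]].
have cF := twist_continuous tF.
have M0 : (0 : R) < M by rewrite ltr0n.
have [h hE] : exists h, M^-1 = h by exists M^-1.
have h0 : 0 < h by rewrite -hE invr_gt0.
have Mh : M * h = 1 by rewrite -hE mulfV// gt_eqF.
have h_eps : 4 * h < eps by rewrite -hE.
have M3 : 3 <= M by rewrite ler_nat.
have h3 : h <= 1 / 3 by nra.
pose u i := F (z i).
have u_low i : (i < N)%N -> h / 4 < (u i).2.
  by move=> iN; have [_ _ hl _] := zP i iN; rewrite /u; nra.
have u_high i : (i < N)%N -> (u i).2 <= 1 by move=> iN; have [] := zP i iN.
have [s0 s0_gt0 s0P] : exists2 s, 0 < s & forall i, (i < N)%N -> forall j, (j < N)%N ->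
    i <> j -> 2 * s <= Num.max `|(u i).1 - (u j).1| `|(u i).2 - (u j).2|.
  apply: (common_pos (P := fun i s => forall j, (j < N)%N -> i <> j ->
      2 * s <= Num.max `|(u i).1 - (u j).1| `|(u i).2 - (u j).2|)).
    by move=> i d e dP /andP[e0 ed] j jN ij; apply: le_trans (dP j jN ij); lra.
  move=> i iN; apply: (common_pos (P := fun j s => i <> j ->
      2 * s <= Num.max `|(u i).1 - (u j).1| `|(u i).2 - (u j).2|)).
    by move=> j d e dP /andP[e0 ed] ij; apply: le_trans (dP ij); lra.
  move=> j jN; have [->|/eqP ij] := eqVneq i j; first by exists 1.
  exists (Num.max `|(u i).1 - (u j).1| `|(u i).2 - (u j).2| / 2); last by lra.
  rewrite divr_gt0// lt_max !normr_gt0 !subr_eq0 -negb_and; apply/negP.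
  move=> /andP[/eqP e1 /eqP e2]; apply/ij/zinj => //; apply: (twist_inj tF).
  by rewrite -/(u i) -/(u j) [LHS]surjective_pairing [RHS]surjective_pairing e1 e2.
pose s := Num.min s0 (h / 8).
have sgt0 : 0 < s by rewrite lt_min s0_gt0 divr_gt0.
have s_s0 : s <= s0 by rewrite ge_min lexx.
have s_h : s <= h / 8 by rewrite ge_min lexx orbT.
have [t0 t0_gt0 t0P] : exists2 t, 0 < t & forall i, (i < N)%N -> forall t', 0 < t' <= t ->
    in_square (u i) s (F (toward n (c i) (z i) t')).
  apply: (common_pos (P := fun i t => forall t', 0 < t' <= t ->
    in_square (u i) s (F (toward n (c i) (z i) t')))).
    by move=> i d e dP /andP[e0 ed] t' /andP[t0 te]; apply: dP; rewrite t0 (le_trans te).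
  move=> i iN; pose f t := F (toward n (c i) (z i) t).
  have cf : continuous f by rewrite /f /toward; cont.
  have f0 : f 0 = u i by rewrite /f /toward !mul0r !addr0 -surjective_pairing.
  by have [d d0 dP] := in_square_near cf sgt0; exists d => //; rewrite f0 in dP.
pose t := Num.min t0 1.
have t_itv : 0 < t <= 1 by rewrite lt_min t0_gt0 ltr01 ge_min lexx orbT.
pose z' i := toward n (c i) (z i) t.
have z'_in i : (i < N)%N -> in_box (lo n (c i)) (hi n (c i)) (z' i).
  by move=> iN; apply: toward_in => //; have [] := zP i iN.
have Fz' i : (i < N)%N -> in_square (u i) s (F (z' i)).
  move=> iN; apply: t0P => //; rewrite ge_min lexx andbT.
  by case/andP: t_itv.
pose v i := toward n (c i.+1) (u i) s.
have v_in i : (i < N)%N -> in_box (lo n (c i.+1)) (hi n (c i.+1)) (v i).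
  move=> iN; apply: toward_in; first by have [] := zP i iN.
  by rewrite sgt0 /=; lra.
have v_in1 i : (i < N)%N -> in_square (u i) s (v i).
  move=> iN; have [_ ub _ _] := zP i iN.
  have [] := toward_close ub (ltW sgt0); rewrite -/(u i) -/(v i) hE.
  have sh : s * h < s by nra.
  rewrite !ler_norml => /andP[h1 h2] /andP[h4 h5].
  by apply/in_squareP; split; apply/andP; split; lra.
(* The first and last bricks reach [h / 2] beyond the strip. The point [q0] there is the image of a
   point at height [- 3 / 4 h], as [iter_bottom] needs, and [e] lies above [1 + h / 4], as
   [iter_top] needs. *)
pose q0 : R * R := (((c 0%N).1%:~R + 1 / 2) / M, - (3 / 8 * h)).
pose e : R * R := (((c N).1%:~R + 1 / 2) / M, 1 + 3 / 8 * h).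
have q0_in : in_box (lo n (c 0%N)) (hi n (c 0%N)) q0.
  rewrite in_brickE /= c0 divfK ?gt_eqF//.
  have -> : - (3 / 8 * h) * M = - (3 / 8).
    by transitivity (- (3 / 8 * (M * h))); [ring|rewrite Mh mulr1].
  by apply/andP; split; apply/andP; split; lra.
have e_in : in_box (lo n (c N)) (hi n (c N)) e.
  rewrite in_brickE /= cN divfK ?gt_eqF//.
  have -> : (1 + 3 / 8 * h) * M = M + 3 / 8.
    by transitivity (M + 3 / 8 * (M * h)); [ring|rewrite Mh mulr1].
  rewrite -[(m%:Z)%:~R]/M; by apply/andP; split; apply/andP; split; lra.
pose b2 i := if i == N then e else z' i.
have b2_in i : (i <= N)%N -> in_box (lo n (c i)) (hi n (c i)) (b2 i).
  move=> iN; rewrite /b2; case: (eqVneq i N) => [->|iN']; first exact: e_in.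
  by apply: z'_in; rewrite ltn_neqAle iN'.
have q0_le : q0.2 <= 0 by rewrite /=; lra.
have s0P' i : (i < N)%N -> forall j, (j < N)%N -> i <> j ->
    2 * s <= Num.max `|(u i).1 - (u j).1| `|(u i).2 - (u j).2|.
  by move=> iN j jN ij; apply: le_trans (s0P i iN j jN ij); lra.
have [Q [cQ injQ [Qq QFz] Qid Qmove]] := two_step_push hE h0 h3 sgt0 s_h cr cinj
  u_low u_high s0P' Fz' v_in1 v_in q0_in q0_le b2_in.
exists (Q \o F); split.
- by rewrite /comp; cont.
- by apply: inj_comp => //; exact: twist_inj tF.
- move=> w w1; rewrite /= Qid// [w]surjective_pairing (twist_bot tF) /=; last by lra.
  by left; lra.
- move=> w w1; rewrite /= Qid// [w]surjective_pairing (twist_top tF) /=; last by lra.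
  by right; lra.
split; last first.
  move=> w; rewrite /=; case: (Qmove (F w)) => [e1|[/andP[r1 r2] m1 m2]].
    have -> : disp (Q \o F) w = disp F w by rewrite /disp /= e1.
    exact/dot_gt0/disp_neq0/(twist_nofix tF).
  (* The two pushes move a point by at most [2 h] in each coordinate, and twice this is below
     [eps]. *)
  apply: (@dot_close _ _ _ (2 * h) eps).
  + by rewrite /disp /= opprB addrA subrK.
  + by rewrite /disp /= opprB addrA subrK.
  + lra.
  + by rewrite mulrA -natrM.
  apply: eps_disp; apply/andP; split; rewrite leNgt; apply/negP => hw.
    move: r1; rewrite [w]surjective_pairing (twist_bot tF) /=; lra.
  move: r2; rewrite [w]surjective_pairing (twist_top tF) /=; lra.
have [x xE] := twist_bot_surj tF q0.1.
have Gq : (Q \o F) (x, - (3 / 4 * h)) = z' 0%N.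
  rewrite /= (twist_bot tF) ?xE; last by lra.
  have -> : (q0.1, - (3 / 4 * h) / 2) = q0.
    by rewrite [RHS]surjective_pairing /=; congr pair; lra.
  by rewrite Qq /b2 eq_sym gtn_eqF.
have run i : (i < N)%N -> iter i (Q \o F) (z' 0%N) = z' i.
  elim: i => [//|i IHi] iN; rewrite iterS IHi ?(ltnW iN)//= QFz ?(ltnW iN)//.
  by rewrite /b2 ltn_eqF.
have runN : iter N (Q \o F) (z' 0%N) = e.
  rewrite -[N in iter N](prednK N0) iterS run ?ltn_predL//= QFz ?ltn_predL//.
  by rewrite prednK// /b2 eqxx.
have GFbot w : w.2 <= - h -> (Q \o F) w = F w.
  move=> w0; rewrite /= Qid// [w]surjective_pairing (twist_bot tF) /=; last by lra.
  by left; lra.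
have GFtop w : 1 + h / 4 <= w.2 -> (Q \o F) w = F w.
  move=> w0; rewrite /= Qid// [w]surjective_pairing (twist_top tF) /=; last by lra.
  by right; lra.
have [|p [k [p2 pk]]] := @iter_bottom (Q \o F) (x, - (3 / 4 * h)) h h0 GFbot.
  by rewrite /=; lra.
have [|l el] := @iter_top (Q \o F) e h h0 GFtop; first by rewrite /=; lra.
(* From [p], [k] steps reach the preimage of [q0], one more reaches [z' 0], [N] steps along the
   chain reach [e], and [l] steps climb to height 2. *)
exists p, (l + (N + k.+1))%N; split=> //.
by rewrite iterD iterD iterS pk Gq runN.
Qed.

End PerturbedMap.

(** * The rotation number of a twist map *)

Section Rotation.
Context {R : realType}.
Variables (F : R * R -> R * R) (g0 g1 : R -> R).
Hypothesis tF : twist_map F g0 g1.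
Hypothesis nofree : forall g u, ~ free_curve F g u.

Lemma disp_bot x y : y <= 0 -> disp F (x, y) = (g0 x - x, - (y / 2)).
Proof. by move=> y0; rewrite /disp (twist_bot tF)//=; congr pair; lra. Qed.

Lemma disp_top x y : 1 <= y -> disp F (x, y) = (g1 x - x, y - 1).
Proof. by move=> y1; rewrite /disp (twist_top tF)//=; congr pair; lra. Qed.

Variable th : R * R -> R.
Hypothesis cth : continuous th.
Hypothesis thP : forall z, angle_of (disp F z) (th z).

Lemma th_bot x : cos (th (x, 0)) = -1 /\ sin (th (x, 0)) = 0.
Proof.
have [r r0] := thP (x, 0); rewrite disp_bot// mul0r oppr0 => -[e1 /esym/eqP].
rewrite mulf_eq0 gt_eqF//= => /eqP s0; split=> //.
have c0 : cos (th (x, 0)) < 0.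
  by rewrite -(pmulr_rlt0 _ r0) -e1 subr_lt0; exact: twist_bot_lt tF x.
have /eqP := cos2Dsin2 (th (x, 0)); rewrite s0 expr0n addr0 sqrf_eq1.
by case/orP => /eqP // c1; move: c0; rewrite c1 ltr10.
Qed.

Lemma th_top x : cos (th (x, 1)) = 1 /\ sin (th (x, 1)) = 0.
Proof.
have [r r0] := thP (x, 1); rewrite disp_top// subrr => -[e1 /esym/eqP].
rewrite mulf_eq0 gt_eqF//= => /eqP s0; split=> //.
have c0 : 0 < cos (th (x, 1)).
  by rewrite -(pmulr_rgt0 _ r0) -e1 subr_gt0; exact: twist_top_gt tF x.
have /eqP := cos2Dsin2 (th (x, 1)); rewrite s0 expr0n addr0 sqrf_eq1.
by case/orP => /eqP // c1; move: c0; rewrite c1 ltr0N1.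
Qed.

(** Everywhere on the half plane below the strip the displacement has a negative first coordinate,
    and on the edge it points exactly to the left. *)
Lemma th_bot_close x z : z.2 <= 0 -> `|th z - th (x, 0)| < pi / 2.
Proof.
move=> z2; pose d t := th ((1 - t) * x + t * z.1, t * z.2) - th (x, 0).
have cd : continuous d by rewrite /d; cont.
have [c0 s0] := th_bot x.
have d0 : d 0 = 0 by rewrite /d subr0 !mul0r mul1r addr0 subrr.
have d1 : d 1 = th z - th (x, 0).
  by rewrite /d subrr mul0r add0r !mul1r -surjective_pairing.
rewrite -[th z - _]subr0 -d1 -d0; apply: cos_gt0_path => //; last by rewrite d0 cos0.
move=> t /andP[t0 t1]; rewrite /d cosB c0 s0 mulr0 addr0 mulrN1 oppr_gt0.
rewrite (angle_cos_lt0 (thP _)) disp_bot /= ?mulr_ge0_le0//.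
by rewrite subr_lt0; exact: twist_bot_lt tF _.
Qed.

Lemma th_top_close x z : 1 <= z.2 -> `|th z - th (x, 1)| < pi / 2.
Proof.
move=> z2; pose d t := th ((1 - t) * x + t * z.1, 1 + t * (z.2 - 1)) - th (x, 1).
have cd : continuous d by rewrite /d; cont.
have [c0 s0] := th_top x.
have d0 : d 0 = 0 by rewrite /d subr0 !mul0r mul1r !addr0 subrr.
have d1 : d 1 = th z - th (x, 1).
  by rewrite /d subrr mul0r add0r !mul1r subrKC -surjective_pairing.
rewrite -[th z - _]subr0 -d1 -d0; apply: cos_gt0_path => //; last by rewrite d0 cos0.
move=> t /andP[t0 t1]; rewrite /d cosB c0 s0 mulr0 addr0 mulr1.
rewrite (angle_cos_sgn (thP _)) disp_top /=.
  by rewrite subr_gt0; exact: twist_top_gt tF _.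
by rewrite lerDl mulr_ge0// subr_ge0.
Qed.

(** The bounds of [index_of_orbit], with errors below [pi / 2] at both ends, put the rotation
    strictly between [- 2 pi] and [pi]. It is an odd multiple of [pi], as the displacements on the
    two edges are opposite in direction. *)
Lemma rotation x0 x1 : th (x1, 1) - th (x0, 0) = - pi.
Proof.
have [eps eps0 epsP] := twist_displacement tF.
have [n n1 nP] : exists2 n : nat, (1 < n)%N & 4 * n.+1%:R^-1 < eps.
  exists (Num.truncn (4 / eps)).+2 => //.
  rewrite ltr_pdivrMr ?ltr0n// mulrC -ltr_pdivrMr//.
  by apply: lt_trans (truncnS_gt (4 / eps)) _; rewrite ltr_nat !ltnS leqnSn.
have chain : exists k c, brick_chain n F k c /\ n.+1%:Z <= (c k).2.
  by have [[g [u /nofree]]|] := free_curve_or_chain tF n1.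
have [G [cG injG Gbot Gtop [[p [k [p2 kp]]] GF]]] :=
  orbit_perturbation tF n1 epsP nP chain.
have Fbot x y : y <= -1 -> F (x, y) = (g0 x, y / 2).
  by move=> y1; rewrite (twist_bot tF)//; lra.
have Ftop x y : 2 <= y -> F (x, y) = (g1 x, y *+ 2 - 1).
  by move=> y1; rewrite (twist_top tF)//; lra.
have [zb [zt [zb2 zt2 /andP[r1 r2]]]] := index_of_orbit cG injG
  (twist_bot_surj tF) (twist_bot_lt tF) (twist_top_gt tF)
  (fun x y y1 => etrans (Gbot (x, y) y1) (Fbot x y y1))
  (fun x y y1 => etrans (Gtop (x, y) y1) (Ftop x y y1)) Fbot Ftop p2 kp GF cth thP.
have := @th_bot_close x0 zb ltac:(lra); have := @th_top_close x1 zt ltac:(lra).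
rewrite !ltr_norml => /andP[a1 a2] /andP[b1 b2].
have [c0 s0] := th_bot x0; have [c1 s1] := th_top x1.
pose E := th (x1, 1) - th (x0, 0) + pi.
have cE : cos E = 1 by rewrite /E cosDpi cosB c0 s0 c1 s1 mulr0 addr0 mul1r opprK.
have pi0 := @pi_gt0 R.
have E1 : - pi < E by rewrite /E; lra.
have E2 : E < 2 * pi by rewrite /E; lra.
suff : E = 0 by rewrite /E; lra.
have [Epi|Epi] := ltP E pi.
  by apply: cos_eq1_small => //; rewrite ltr_norml E1.
have c2 : cos (2 * pi - E) = 1.
  by rewrite (_ : 2 * pi - E = - E + pi *+ 2); [rewrite cosD2pi cosN|ring].
have : 2 * pi - E = 0.
  apply: cos_eq1_small => //; rewrite gtr0_norm; last by lra.
  rewrite ltNge; apply/negP => h; have e : E = pi by lra.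
  by move: cE; rewrite e cospi; lra.
lra.
Qed.

End Rotation.

(** * Curves in the annulus and the main theorem *)

Section Strip.
Context {R : realType}.
Implicit Types (x y : R) (q : unit_interval R).

Lemma clamp01_mem y : clamp01 y \in (`[0, 1]%classic : set R).
Proof. by apply/mem_set; rewrite /= in_itv /=; exact: clamp01_itv. Qed.

Definition to_unit y : unit_interval R := exist _ (clamp01 y) (clamp01_mem y).

Definition height q : R := sval q.

Lemma height_continuous : continuous height.
Proof.
have := @initial_continuous (unit_interval R) R set_val.
by rewrite set_valE.
Qed.

Lemma to_unit_continuous : continuous to_unit.
Proof.
rewrite /to_unit; apply: continuous_comp_initial.
exact: clamp01_continuous.
Qed.

Lemma height_itv q : 0 <= height q <= 1.
Proof. by case: q => y /= /set_mem; rewrite /= in_itv. Qed.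

Lemma to_unitK y : 0 <= y <= 1 -> height (to_unit y) = y.
Proof. exact: clamp01_id. Qed.

Lemma heightK q : to_unit (height q) = q.
Proof. by apply: val_inj => /=; rewrite clamp01_id// height_itv. Qed.

Lemma to_unit0 y : y <= 0 -> to_unit y = I0 R.
Proof. by move=> y0; apply: val_inj => /=; exact: clamp01_le0. Qed.

Lemma to_unit1 y : 1 <= y -> to_unit y = I1 R.
Proof. by move=> y1; apply: val_inj => /=; exact: clamp01_ge1. Qed.

(** Outside the strip, points move horizontally like the nearest edge. The correction terms vanish
    on the strip and, when [H] preserves the edges, give the heights [y / 2] below and [2 y - 1]
    above. *)
Definition extend_strip (H : strip R -> strip R) (p : R * R) : R * R :=
  ((H (p.1, to_unit p.2)).1,
   height (H (p.1, to_unit p.2)).2 + Num.min 0 p.2 / 2 + Num.max 0 (p.2 - 1) * 2).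

Lemma extend_stripE H x y : 0 <= y <= 1 -> extend_strip H (x, y) =
  ((H (x, to_unit y)).1, height (H (x, to_unit y)).2).
Proof.
move=> /andP[y0 y1]; rewrite /extend_strip /= min_l// max_l ?subr_le0//.
by rewrite !mul0r !addr0.
Qed.

Lemma twist_map_of_strip (H : strip R -> strip R) :
  continuous H -> injective H ->
  (forall x q, H (x + 1, q) = ((H (x, q)).1 + 1, (H (x, q)).2)) ->
  (forall p, H p <> p) ->
  (forall x, (H (x, I0 R)).1 < x /\ (H (x, I0 R)).2 = I0 R) ->
  (forall x, x < (H (x, I1 R)).1 /\ (H (x, I1 R)).2 = I1 R) ->
  twist_map (extend_strip H) (fun x => (H (x, I0 R)).1) (fun x => (H (x, I1 R)).1).
Proof.
move=> cH injH Hper Hfix Hbot Htop.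
have cu := to_unit_continuous; have ch := height_continuous.
have bot x y : y <= 0 -> extend_strip H (x, y) = ((H (x, I0 R)).1, y / 2).
  move=> y0; rewrite /extend_strip /= to_unit0// (Hbot x).2 min_r// max_l; last by lra.
  by rewrite mul0r addr0 add0r.
have top x y : 1 <= y -> extend_strip H (x, y) = ((H (x, I1 R)).1, y *+ 2 - 1).
  move=> y1; rewrite /extend_strip /= to_unit1// (Htop x).2 min_l; last by lra.
  by rewrite max_r; [congr pair; rewrite /height /=; lra|lra].
have mid x y : 0 <= y <= 1 -> 0 <= (extend_strip H (x, y)).2 <= 1.
  by move=> y01; rewrite extend_stripE//= height_itv.
(* The strip and the regions below and above it are each mapped into themselves, so injectivity and
   absence of fixed points are checked in each. *)
have sep x y : [\/ y < 0 /\ (extend_strip H (x, y)).2 < 0,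
    0 <= y <= 1 /\ 0 <= (extend_strip H (x, y)).2 <= 1 |
    1 < y /\ 1 < (extend_strip H (x, y)).2].
  have [y0|y0] := ltP y 0.
    by constructor 1; split=> //; rewrite bot ?ltW//=; lra.
  have [y1|y1] := leP y 1.
    have y01 : 0 <= y <= 1 by rewrite y0.
    by constructor 2; rewrite mid.
  by constructor 3; split=> //; rewrite top ?ltW//=; lra.
split=> //.
- by rewrite /extend_strip; cont.
- move=> [x y] [x' y'] e; have := sep x y; have := sep x' y'; rewrite -e.
  case=> -[y'1 h'] [] -[y1 h]; try (exfalso; clear -h h'; lra).
  + move: e; rewrite !bot ?ltW// => -[e1 e2].
    have yy : y = y' by lra.
    have := injH (x, I0 R) (x', I0 R).
    rewrite [H (x, _)]surjective_pairing [H (x', _)]surjective_pairing e1.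
    by rewrite (Hbot x).2 (Hbot x').2 yy => /(_ erefl)[->].
  + move: e; rewrite !extend_stripE// => -[e1 e2].
    have := injH (x, to_unit y) (x', to_unit y').
    rewrite [H (x, _)]surjective_pairing [H (x', _)]surjective_pairing e1.
    move/val_inj: e2 => -> /(_ erefl)[->].
    by rewrite !clamp01_id// => ->.
  + move: e; rewrite !top ?ltW// => -[e1 e2].
    have yy : y = y' by lra.
    have := injH (x, I1 R) (x', I1 R).
    rewrite [H (x, _)]surjective_pairing [H (x', _)]surjective_pairing e1.
    by rewrite (Htop x).2 (Htop x').2 yy => /(_ erefl)[->].
- by move=> x y; rewrite /extend_strip /= Hper.
- move=> [x y]; apply/eqP => e; case: (sep x y) => -[y1 _].
  + by move: e; rewrite bot ?ltW// => -[_]; lra.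
  + move: e; rewrite extend_stripE// => -[e1 e2]; apply: (Hfix (x, to_unit y)).
    rewrite [LHS]surjective_pairing e1; congr pair.
    by rewrite -[LHS]heightK e2.
  + by move: e; rewrite top ?ltW// => -[_]; lra.
- by move=> x; case: (Hbot x).
- by move=> x; case: (Htop x).
Qed.

End Strip.

(** * Degree and lifts of closed curves in the annulus *)

Section CircleCurve.
Context {R : realType}.
Implicit Types (x y s t : R).

Lemma circle_repr_int x : (repr (circle_pi x) - x) \is a Num.int.
Proof. by apply/circle_piP; rewrite /circle_pi reprK. Qed.

Lemma circle_pi_surj (q : circle R) : exists x, q = circle_pi x.
Proof. by exists (repr q); rewrite /circle_pi reprK. Qed.

Lemma circle_pi_continuous : continuous (@circle_pi R).
Proof. exact: pi_continuous. Qed.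

Lemma circle_continuous (Z : topologicalType) (f : circle R -> Z) :
  continuous (fun x => f (circle_pi x)) -> continuous f.
Proof. by move=> h; apply/quotient_continuous. Qed.

Definition circle_lift (T : Type) (f : R -> T) (q : circle R) : T := f (repr q).

Lemma circle_liftE (T : Type) (f : R -> T) x :
  (forall s t, (s - t) \is a Num.int -> f s = f t) -> circle_lift f (circle_pi x) = f x.
Proof. by move=> h; apply: h; exact: circle_repr_int. Qed.

Lemma circle_lift_continuous (Z : topologicalType) (f : R -> Z) :
  (forall s t, (s - t) \is a Num.int -> f s = f t) -> continuous f ->
  continuous (circle_lift f).
Proof.
move=> fper cf; apply: circle_continuous.
rewrite [X in continuous X](_ : _ = f)//.
by apply/funext => x; exact: circle_liftE.
Qed.

Definition unit_vec x : R * R := (cos (2 * pi * x), sin (2 * pi * x)).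

Lemma unit_vec_per s t : (s - t) \is a Num.int -> unit_vec s = unit_vec t.
Proof.
have nat_case (k : nat) u : unit_vec (u + k%:R) = unit_vec u.
  have e : 2 * pi * (u + k%:R) = 2 * pi * u + (pi *+ 2) *+ k.
    by rewrite mulrDr -[(pi *+ 2) *+ k]mulr_natr -[pi *+ 2]mulr_natl.
  by rewrite /unit_vec e (periodicn (@cosD2pi R)) (periodicn (@sinD2pi R)).
move=> /intrP[[k|k] e]; rewrite -(subrK t s) e addrC; first exact: nat_case.
by rewrite NegzE intrN -[LHS](nat_case k.+1) subrK.
Qed.

Lemma unit_vec_angle x : angle_of (unit_vec x) (2 * pi * x).
Proof. by exists 1; rewrite ?ltr01// !mul1r. Qed.

Lemma unit_vec_continuous : continuous unit_vec.
Proof.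
have cc := @continuous_cos R; have cs := @continuous_sin R.
by rewrite /unit_vec; cont.
Qed.

Lemma unit_vec_neq0 x : unit_vec x != (0, 0).
Proof.
apply/eqP => -[c0 s0]; have := cos2Dsin2 (2 * pi * x).
by rewrite c0 s0 expr0n addr0 => /eqP; rewrite eq_sym oner_eq0.
Qed.

(** A contraction would give a map [W] of a square to the unit circle that turns by [2 pi u] along
    the bottom, is constant along the top and agrees on the two vertical sides, which forces
    [u = 0]. *)
Lemma essential_of_degree (g : R -> R * R) (u : int) (c : circle R -> annulus R) :
  u != 0 -> continuous g -> (g 1).1 = (g 0).1 + u%:~R ->
  (forall s, (c (circle_pi s)).1 = circle_pi (g s).1) -> essential_curve c.
Proof.
move=> u0 cg gu cE [H [p [cH H0 H1]]].
pose e := circle_lift unit_vec.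
have eE x : e (circle_pi x) = unit_vec x by apply: circle_liftE; exact: unit_vec_per.
have ce : continuous e.
  by apply: circle_lift_continuous; [exact: unit_vec_per|exact: unit_vec_continuous].
have cp := circle_pi_continuous; have cu := @to_unit_continuous R.
pose W (z : R * R) := e (H (circle_pi z.1, to_unit z.2)).1.
have cW : continuous W by rewrite /W; cont.
have W0 z : W z != (0, 0).
  by rewrite /W; have [x ->] := circle_pi_surj (H (circle_pi z.1, to_unit z.2)).1;
    rewrite eE unit_vec_neq0.
have [th cth thP] := angle_lift cW W0.
have Wbot s : W (s, 0) = unit_vec (g s).1 by rewrite /W /= to_unit0// H0 cE eE.
have Wtop s : W (s, 1) = W (0, 1) by rewrite /W /= to_unit1// !H1.
have e10 : circle_pi (1 : R) = circle_pi 0.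
  by apply/circle_piP; rewrite subr0.
have Wside t : W (1, t) = W (0, t) by rewrite /W /= e10.
have bot : th (1, 0) - th (0, 0) = 2 * pi * u%:~R.
  pose d s := th (s, 0) - 2 * pi * (g s).1.
  have cd : continuous d by rewrite /d; cont.
  have : d 1 = d 0.
    apply: cos_eq1_path => // s _; apply: angle_cos_eq1 (thP _) _.
    by rewrite Wbot; exact: unit_vec_angle.
  by rewrite /d gu; lra.
have top : th (1, 1) - th (0, 1) = 0.
  pose d s := th (s, 1) - th (0, 1).
  have cd : continuous d by rewrite /d; cont.
  have : d 1 = d 0.
    apply: cos_eq1_path => // s _; apply: angle_cos_eq1 (thP _) _.
    by rewrite Wtop.
  by rewrite /d subrr.
have side : th (1, 1) - th (0, 1) = th (1, 0) - th (0, 0).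
  pose d t := th (1, t) - th (0, t).
  have cd : continuous d by rewrite /d; cont.
  apply: (@cos_eq1_path R d) => // t _; apply: angle_cos_eq1 (thP _) _.
  by rewrite Wside.
have := bot; rewrite -side top => /esym/eqP; apply/negP.
by rewrite !mulf_neq0 ?pnatr_eq0 ?intr_eq0// gt_eqF// pi_gt0.
Qed.

(** The projection of [g] would be an essential simple closed curve, and a point where it meets its
    image lifts to a point of the image of [g] on a translate of [g]. *)
Lemma no_free_curve (f : annulus R -> annulus R) (F : strip R -> strip R) :
  intersection_property f -> (forall p, annulus_pi (F p) = f (annulus_pi p)) ->
  forall g u, ~ free_curve (extend_strip F) g u.
Proof.
move=> finter Ff g u [u0 cg gper ginj [g01 gfree]].
have gperZ (k : int) s : g (s + k%:~R) = ((g s).1 + k%:~R * u%:~R, (g s).2).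
  have nat_case (l : nat) s' : g (s' + l%:R) = ((g s').1 + l%:R * u%:~R, (g s').2).
    elim: l => [|l IHl]; first by rewrite mul0r !addr0 -surjective_pairing.
    by rewrite -natr1 addrA gper IHl /= mulrDl mul1r addrA.
  case: k => l; first exact: nat_case.
  rewrite NegzE intrN /=; have := nat_case l.+1 (s - l.+1%:R).
  by rewrite subrK => ->; rewrite /= mulNr addrK -surjective_pairing.
have cp := circle_pi_continuous; have cu := @to_unit_continuous R.
pose d s : annulus R := (circle_pi (g s).1, to_unit (g s).2).
have dper s t : (s - t) \is a Num.int -> d s = d t.
  move=> /intrP[k e]; rewrite -(subrK t s) e addrC /d gperZ /=; congr pair.
  by apply/circle_piP; rewrite addrC addKr rpredM ?intr_int.
have cd : continuous d by rewrite /d; cont.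
pose c := circle_lift d.
have cE s : c (circle_pi s) = d s by exact: circle_liftE.
have csimple : simple_closed_curve c.
  split; first exact: circle_lift_continuous.
  move=> q q'; have [s ->] := circle_pi_surj q; have [t ->] := circle_pi_surj q'.
  rewrite !cE /d => -[/circle_piP/intrP[k k1]].
  rewrite !clamp01_id// => e2; apply/circle_piP/(ginj s t k).
  by rewrite [LHS]surjective_pairing e2 -k1 subrKC.
have cess : essential_curve c.
  apply: (@essential_of_degree g u) => //; last by move=> s; rewrite cE.
  by have := gper 0; rewrite add0r => ->.
have [w [[w' [q _ <-] <-] [q' _]]] := finter c csimple cess.
have [s ->] := circle_pi_surj q; have [t ->] := circle_pi_surj q'.
rewrite !cE => e.
have : annulus_pi (F ((g s).1, to_unit (g s).2)) = d t by rewrite Ff e.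
rewrite /annulus_pi /d => -[/circle_piP/intrP[k k1] e2].
apply: (gfree s t k).
by rewrite [g s]surjective_pairing extend_stripE// e2 to_unitK// -k1 subrKC.
Qed.

End CircleCurve.

(** * Periodicity of the lift *)

Section Lift.
Context {R : realType}.

Lemma int_valued_cst (d : R -> R) : continuous d ->
  (forall t, d t \is a Num.int) -> d 1 = d 0.
Proof.
move=> cd dint; apply: (@mulfI _ (2 * pi)).
  by rewrite mulf_neq0 ?pnatr_eq0// gt_eqF// pi_gt0.
apply: (@cos_eq1_path R (fun t => 2 * pi * d t)) => //; first by cont.
move=> t _; have := @unit_vec_per R (d t) 0; rewrite subr0 => /(_ (dint t)) [-> _].
by rewrite mulr0 cos0.
Qed.

Variables (f : annulus R -> annulus R) (F : strip R -> strip R).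
Hypothesis cF : continuous F.
Hypothesis Ff : forall p, annulus_pi (F p) = f (annulus_pi p).
Variables r0 r1 : R -> R.
Hypothesis r0_gt0 : forall x, 0 < r0 x.
Hypothesis r1_gt0 : forall x, 0 < r1 x.
Hypothesis Fbot : forall x, F (x, I0 R) = (x - r0 x, I0 R).
Hypothesis Ftop : forall x, F (x, I1 R) = (x + r1 x, I1 R).

(* The degree [D] of [f] is an integer with [r1 (x + 1) = r1 x + (D - 1)] and
   [r0 (x + 1) = r0 x + (1 - D)]: positivity of [r1] and [r0] forces [D = 1]. *)
Lemma lift_periodic x q : F (x + 1, q) = ((F (x, q)).1 + 1, (F (x, q)).2).
Proof.
have cu := @to_unit_continuous R.
have pi1 (y : R) p : annulus_pi (F (y + 1, p)) = annulus_pi (F (y, p)).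
  rewrite !Ff; congr f; rewrite /annulus_pi /=; congr pair.
  by apply/circle_piP; rewrite addrAC subrr add0r.
pose D (y : R) p := (F (y + 1, p)).1 - (F (y, p)).1.
have Dint y p : D y p \is a Num.int.
  by have := pi1 y p; rewrite /annulus_pi => -[/circle_piP].
have Dcst y p z h : D z (to_unit h) = D y p.
  rewrite -(heightK p).
  pose d t := D (y + t * (z - y)) (to_unit (height p + t * (h - height p))).
  have cd : continuous d by rewrite /d /D; cont.
  have : d 1 = d 0 by apply: (int_valued_cst cd) => t; exact: Dint.
  by rewrite /d !mul0r !mul1r !addr0 !subrKC.
have [k kE] := intrP (Dint x q).
have D1 y : D y (I1 R) = k%:~R.
  by rewrite -kE -(to_unit1 (lexx 1)) (Dcst x q).
have D0 y : D y (I0 R) = k%:~R.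
  by rewrite -kE -(to_unit0 (lexx 0)) (Dcst x q).
(* A negative increment [a] would make [r] negative at large integers. *)
have arith (r : R -> R) (a : int) : (forall y, 0 < r y) ->
    (forall y, r (y + 1) = r y + a%:~R) -> 0 <= a.
  move=> rpos rper; rewrite leNgt; apply/negP => a0.
  have rn (n : nat) : r n%:R = r 0 + n%:R * a%:~R.
    elim: n => [|n IHn]; first by rewrite mul0r addr0.
    by rewrite -natr1 rper IHn mulrDl mul1r addrA.
  have := rpos (Num.truncn (r 0)).+1%:R; rewrite rn; apply/negP; rewrite -leNgt.
  have a1 : a%:~R <= -1 :> R by rewrite -[-1]/((-1)%:~R) ler_int; lia.
  have := truncnS_gt (r 0); set N : R := _%:R => hN.
  have N0 : 0 <= N by rewrite ler0n.
  have := ler_wpM2l N0 a1; lra.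
have k1 : 0 <= k - 1.
  apply: (arith r1) => // y; have := D1 y; rewrite /D !Ftop /= intrB => h.
  by have : k%:~R = y + 1 + r1 (y + 1) - (y + r1 y) by []; lra.
have k2 : 0 <= 1 - k.
  apply: (arith r0) => // y; have := D0 y; rewrite /D !Fbot /= intrB => h.
  by have : k%:~R = y + 1 - r0 (y + 1) - (y - r0 y) by []; lra.
have {}kE : D x q = 1 by rewrite kE (_ : k = 1)//; lia.
rewrite [LHS]surjective_pairing; congr pair; first by move: kE; rewrite /D; lra.
by have := pi1 x q; rewrite /annulus_pi => -[_].
Qed.

End Lift.

(** * The mirrored inverse and the conclusion *)

Definition mirror {R : realType} (p : R * R) : R * R := (- p.1, p.2).

(** A curve is disjoint from its image under a bijection exactly when it is disjoint from its image
    under the inverse. Here [F'] inverts [F] up to conjugation by [mirror], which reverses the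
    degree. *)
Lemma free_curve_mirror (R : realType) (F F' : R * R -> R * R) g u :
  (forall p, 0 <= p.2 <= 1 -> F' (mirror (F (mirror p))) = p) ->
  (forall (k : int) x y, F' (x + k%:~R, y) = ((F' (x, y)).1 + k%:~R, (F' (x, y)).2)) ->
  free_curve F' g u -> free_curve F (fun s => mirror (g s)) (- u).
Proof.
move=> F'F F'per [u0 cg gper ginj [g01 gfree]]; split=> //.
- by rewrite oppr_eq0.
- by rewrite /mirror; cont.
- by move=> s; rewrite gper /mirror /= opprD intrN.
- move=> s t z [] /(congr1 -%R); rewrite opprD !opprK -intrN => e1 e2.
  by apply: (ginj s t (- z)); rewrite [LHS]surjective_pairing e1 e2.
split=> // s t z e; apply: (gfree t s z).
have := F'F (g s) (g01 s); rewrite e /mirror /= opprD opprK -intrN.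
rewrite F'per => <- /=.
by rewrite intrN subrK -!surjective_pairing.
Qed.

(* The displacement of the inverse at [F z] is the opposite of the displacement of
   [F] at [z], so the mirrored inverse turns the other way. *)
Lemma twist_has_free_curve (R : realType) (F F' : R * R -> R * R) (g0 g1 g0' g1' : R -> R) :
  twist_map F g0 g1 -> twist_map F' g0' g1' ->
  (forall p, 0 <= p.2 <= 1 -> F' (mirror (F p)) = mirror p) ->
  (exists g u, free_curve F g u) \/ (exists g u, free_curve F' g u).
Proof.
move=> tF tF' F'F; apply: contrapT => /not_orP[nF nF'].
have {}nF g u : ~ free_curve F g u by move=> h; apply: nF; exists g, u.
have {}nF' g u : ~ free_curve F' g u by move=> h; apply: nF'; exists g, u.
have cF := twist_continuous tF; have cF' := twist_continuous tF'.
have [th cth thP] := angle_lift (disp_continuous cF)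
  (fun z => disp_neq0 (twist_nofix tF z)).
have [th' cth' th'P] := angle_lift (disp_continuous cF')
  (fun z => disp_neq0 (twist_nofix tF' z)).
(* The displacement of [F'] at [mirror (F z)] is that of [F] at [z] with its second coordinate
   negated, so its angle is [- th z] up to full turns. Hence the rotations are opposite, while
   [rotation] makes both [- pi]. *)
pose d t := th' (mirror (F (0, t))) + th (0, t).
have cd : continuous d by rewrite /d /mirror; cont.
have : d 1 = d 0.
  apply: cos_eq1_path => // t t01; rewrite /d -[th (0, t)]opprK.
  apply: (angle_cos_eq1 (th'P _)); have [r r0 rE] := thP (0, t).
  exists r => //; rewrite cosN sinN mulrN; move: rE; rewrite /disp /= => -[e1 e2].
  by rewrite F'F// /mirror /= -e1 -e2; congr pair; ring.
have rF := rotation tF nF cth thP 0 0.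
have F0 : F (0, 0) = (g0 0, 0) by rewrite (twist_bot tF)// mul0r.
have F1 : F (0, 1) = (g1 0, 1) by rewrite (twist_top tF)// mulr2n addrK.
rewrite /d /mirror F0 F1 /=.
have rF' := rotation tF' nF' cth' th'P (- g0 0) (- g1 0).
have := @pi_gt0 R; lra.
Qed.

Theorem theorem1p1 (R : realType) (f : annulus R -> annulus R)
  (f_homeo : homeomorphism f)
  (f_twist : twist_condition f)
  (f_inter : intersection_property f) :
  exists z : annulus R, f z = z.
Proof.
apply: contrapT => nofix.
have [F [[cF [G [cG FK GK]]] Ff] [r0 [r1 rP]]] := f_twist.
have {}Ff p : annulus_pi (F p) = f (annulus_pi p) by exact: Ff.
have Ftop x : F (x, I1 R) = (x + r1 x, I1 R) by case: (rP x).
have Fbot x : F (x, I0 R) = (x - r0 x, I0 R) by case: (rP x).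
have r0_gt0 x : 0 < r0 x by case: (rP x).
have r1_gt0 x : 0 < r1 x by case: (rP x).
have Fper := lift_periodic cF Ff r0_gt0 r1_gt0 Fbot Ftop.
have Gper x q : G (x + 1, q) = ((G (x, q)).1 + 1, (G (x, q)).2).
  apply: (can_inj FK); rewrite GK Fper -!surjective_pairing GK; by [].
have nofixF p : F p <> p.
  by move=> e; apply: nofix; exists (annulus_pi p); rewrite -Ff e.
have tF : twist_map (extend_strip F) (fun x => (F (x, I0 R)).1) (fun x => (F (x, I1 R)).1).
  apply: twist_map_of_strip => //; first exact: can_inj FK.
  - by move=> x; rewrite Fbot /=; split=> //; rewrite gtrBl.
  - by move=> x; rewrite Ftop /=; split=> //; rewrite ltrDl.
(* The boundary map of [F] is onto, so each point of the edge is the image of a point of that edge,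
   displaced to the left. *)
have Gbot x : x < (G (x, I0 R)).1 /\ (G (x, I0 R)).2 = I0 R.
  have [x'] := twist_bot_surj tF x; rewrite Fbot /= => <-.
  by rewrite -Fbot FK /=; split=> //; rewrite gtrBl.
have Gtop x : (G (x, I1 R)).1 < x /\ (G (x, I1 R)).2 = I1 R.
  have [x'] := twist_top_surj tF x; rewrite Ftop /= => <-.
  by rewrite -Ftop FK /=; split=> //; rewrite ltrDl.
(* The inverse [G] moves the edges in the reversed directions, and conjugation by the mirror
   restores those of the twist condition. *)
pose H (p : strip R) : strip R := (- (G (- p.1, p.2)).1, (G (- p.1, p.2)).2).
have tH : twist_map (extend_strip H) (fun x => (H (x, I0 R)).1) (fun x => (H (x, I1 R)).1).
  apply: twist_map_of_strip.
  - by rewrite /H; cont.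
  - move=> [x q] [x' q'] [/oppr_inj e1 e2].
    have : G (- x, q) = G (- x', q').
      by rewrite [LHS]surjective_pairing [RHS]surjective_pairing e1 e2.
    by move/(can_inj GK) => [/oppr_inj -> ->].
  - move=> x q; rewrite /H /= opprD; have := Gper (- x - 1) q.
    by rewrite subrK => ->; rewrite /= opprD subrK.
  - move=> [x q] [e1 e2]; apply: (nofixF (- x, q)).
    rewrite -[in RHS](GK (- x, q)); congr F.
    rewrite [RHS]surjective_pairing; congr pair; last exact: esym e2.
    by apply: oppr_inj; rewrite e1 opprK.
  - by move=> x; have [h1 h2] := Gbot (- x); rewrite /H /=; split=> //; lra.
  - by move=> x; have [h1 h2] := Gtop (- x); rewrite /H /=; split=> //; lra.
have HF p : 0 <= p.2 <= 1 -> extend_strip H (mirror (extend_strip F p)) = mirror p.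
  case: p => x y y01; rewrite (@extend_stripE _ F x y y01) /mirror [_.1]/=.
  rewrite extend_stripE ?height_itv//.
  rewrite heightK /H /= opprK -surjective_pairing FK /= clamp01_id//.
have nofree := no_free_curve f_inter Ff.
have [[g [u /nofree //]]|[g [u fr]]] := twist_has_free_curve tF tH HF.
apply: (nofree _ _ (free_curve_mirror _ (twist_periodicZ tH) fr)) => p p01.
by rewrite HF// /mirror /= opprK -surjective_pairing.
Qed.
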